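(* For integers $k,j\ge1$, set $$\mathcal{U}_{2k}(q)=\frac{U_{2k}(q)}{U(1;q)},\qquad W_{2j}(\tau)=u_{2j}(\tau)+\frac{B_{2j}}{4j},$$ where $U_{2k}(q)$ is the $2k$-th unimodal rank moment generating function. Then for every integer $k\ge1$, $$\mathcal{U}_{2k}(q)=\mathrm{Tr}_k\left(\phi_M;\,W_2,W_4,\ldots,W_{2k}\right)$$ and $$W_{2k}(\tau)=\mathrm{Tr}_k\left(\phi_S;\,\mathcal{U}_2(q),\mathcal{U}_4(q),\ldots,\mathcal{U}_{2k}(q)\right).$$
   Context: Here $q=e^{2\pi i\tau}$ with $\mathrm{Im}(\tau)>0$, $\zeta=e^{2\pi iz}$, $(a)_n=\prod_{j=1}^n(1-aq^{j-1})$. A weakly unimodal sequence of weight $n$ is a sequence $a_1\le\cdots\le a_r\le\overline{c}\ge b_1\ge\cdots\ge b_s$ with $\sum a_i+\sum b_j+c=n$ (the overline marks the peak); its rank is $r-s$; $u(m,n)$ is the number of weakly unimodal sequences of weight $n$ and rank $m$. The generating function is $$U(\zeta;q)=\sum_{n\ge0}\sum_{m\in\mathbb{Z}}u(m,n)\zeta^mq^n=\sum_{n\ge0}\frac{q^n}{(\zeta q)_n(q/\zeta)_n},$$ and $U_k(q)=\left.\left(\zeta\frac{d}{d\zeta}\right)^kU(\zeta;q)\right|_{\zeta=1}$. The functions $u_k(\tau)$, $k\ge1$, are defined by the expansion in powers of $z$ $$U(\zeta;q)=\frac{\sin(\pi z)}{\pi z}\,U(1;q)\exp\left(2\sum_{k\ge1}u_k(\tau)\frac{(2\pi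 iz)^k}{k!}\right).$$ $B_n$ is the $n$-th Bernoulli number. A partition $\lambda\vdash k$ is written $\lambda=(1^{m_1},\ldots,k^{m_k})$, with $m_j\ge0$ the multiplicity of the part $j$ and $\sum_jjm_j=k$; $\ell(\lambda)=m_1+\cdots+m_k$. For a function $\phi$ on partitions, $\mathrm{Tr}_k(\phi;X_1,\ldots,X_k)=\sum_{\lambda\vdash k}\phi(\lambda)\prod_{j=1}^kX_j^{m_j}$. For $\lambda\vdash k$, $$\phi_M(\lambda)=(2k)!\prod_{j=1}^k\frac{2^{m_j}}{m_j!\,((2j)!)^{m_j}},\qquad \phi_S(\lambda)=\frac{(2k)!}{2}(-1)^{\ell(\lambda)-1}(\ell(\lambda)-1)!\prod_{j=1}^k\frac{1}{m_j!\,((2j)!)^{m_j}}.$$ *)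

(* Defs.v *)
From HB Require Import structures.
From mathcomp Require Import all_boot all_order all_algebra.
From mathcomp Require Import complex.
From mathcomp Require Import all_classical all_reals all_analysis.

Set Implicit Arguments.
Unset Strict Implicit.
Unset Printing Implicit Defensive.

Import Order.TTheory GRing.Theory Num.Theory.
Import numFieldNormedType.Exports.

Local Open Scope classical_set_scope.
Local Open Scope ring_scope.

(* R[i] seen as a numClosedFieldType, so that it carries the topology (and the
   complex derivative derive1) that MathComp-Analysis puts on every numFieldType. *)
Definition Cplx (R : realType) : numClosedFieldType := R[i].

Section ComplexFunctions.
Variable R : realType.
Local Notation C := (Cplx R).

Definition piC : C := real_complex R pi.

Definition cexp (z : C) : C :=
  Complex (expR (complex.Re z) * cos (complex.Im z))
          (expR (complex.Re z) * sin (complex.Im z)).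

Definition csin (z : C) : C := (cexp ('i * z) - cexp (- ('i * z))) / (2 * 'i).

Definition nome (tau : C) : C := cexp (2 * piC * 'i * tau).

End ComplexFunctions.

(* Bernoulli numbers: B_0 = 1 and sum_(k <= n) 'C(n.+1, k) B_k = 0 for n > 0;
   [bernoulli_upto n] is [:: B_0; ...; B_n]. *)
Fixpoint bernoulli_upto (n : nat) : seq rat :=
  if n is n'.+1 then
    let s := bernoulli_upto n' in
    rcons s (- (\sum_(k < n) 'C(n.+1, k)%:R * s`_k) / n.+1%:R)
  else [:: 1].

Definition bernoulli_number (n : nat) : rat := (bernoulli_upto n)`_n.

(* a_1 <= ... <= a_r <= c >= b_1 >= ... >= b_s, where the parts a_i and b_j are
   positive; the peak c may be 0 only in the sequence of weight 0. *)
Definition weakly_unimodal (a : seq nat) (c : nat) (b : seq nat) : bool :=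
  [&& sorted leq (rcons a c), sorted geq (c :: b), 0%N \notin a & 0%N \notin b].

(* u(m, n). The parts being positive, in a sequence of weight n both sides have
   length at most n and all entries are at most n. *)
Definition unimodal_count (m : int) (n : nat) : nat :=
  #|[set t : n.-bseq 'I_n.+1 * 'I_n.+1 * n.-bseq 'I_n.+1 |
     let a := map val t.1.1 in let c := val t.1.2 in let b := map val t.2 in
     [&& weakly_unimodal a c b,
         (sumn a + c + sumn b == n)%N &
         (size a)%:Z - (size b)%:Z == m]]|.

Section UnimodalRank.
Variable R : realType.
Local Notation C := (Cplx R).

(* Convergent (absolutely, as a double series) for |q| < |zeta| < 1 / |q|. *)
Definition unimodal_gf (zeta q : C) : C :=
  limn (fun N => \sum_(0 <= n < N)
    \sum_(m \in [set: int]) (unimodal_count m n)%:R * zeta ^ m * q ^+ n).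

Definition unimodal_moment (k : nat) (q : C) : C :=
  iter k (fun (f : C -> C) zeta => zeta * derive1 f zeta) (unimodal_gf ^~ q) 1.

Definition normalized_moment (k : nat) (q : C) : C :=
  unimodal_moment k q / unimodal_gf 1 q.

(* The expansion in powers of z that defines the u_k(tau), k >= 1: it holds for
   all z <> 0 close to 0 (u 0 is irrelevant). *)
Definition unimodal_expansion (u : nat -> C -> C) (tau : C) : Prop :=
  \forall z \near (0 : C)^',
    exists2 S : C,
      (fun N => \sum_(1 <= k < N) u k tau * (2 * piC R * 'i * z) ^+ k / k`!%:R)
        @ \oo --> S &
      unimodal_gf (cexp (2 * piC R * 'i * z)) (nome tau) =
        csin (piC R * z) / (piC R * z) * unimodal_gf 1 (nome tau) * cexp (2 * S).

(* W_(2j) = u_(2j) + B_(2j) / (4j); the first argument is the index 2j. *)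
Definition unimodal_W (u : nat -> C -> C) (n : nat) (tau : C) : C :=
  u n tau + ratr (bernoulli_number n) / (2 * n)%:R.

End UnimodalRank.

(* A partition of k is given by its multiplicities: m i is the multiplicity of
   the part i.+1, for i < k. *)
Definition multiplicities (k : nat) := {ffun 'I_k -> 'I_k.+1}.

Definition is_partition (k : nat) (m : multiplicities k) : bool :=
  (\sum_(i < k) i.+1 * m i == k)%N.

Definition partition_length (k : nat) (m : multiplicities k) : nat :=
  (\sum_(i < k) m i)%N.

Section Trace.
Variable F : fieldType.

(* Only X 1, ..., X k are used. *)
Definition partition_trace (k : nat) (phi : multiplicities k -> F)
    (X : nat -> F) : F :=
  \sum_(m : multiplicities k | is_partition m)
    phi m * \prod_(i < k) X i.+1 ^+ m i.

Definition phiM (k : nat) (m : multiplicities k) : F :=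
  (2 * k)`!%:R *
  \prod_(i < k) (2 ^+ m i / ((m i)`!%:R * (2 * i.+1)`!%:R ^+ m i)).

Definition phiS (k : nat) (m : multiplicities k) : F :=
  (2 * k)`!%:R / 2 * (-1) ^+ (partition_length m).-1 *
  ((partition_length m).-1)`!%:R *
  \prod_(i < k) (1 / ((m i)`!%:R * (2 * i.+1)`!%:R ^+ m i)).

End Trace.

(* Main.v *)
(* Write w = 2 pi i z and F(w) = U(e^w; q).  The defining expansion says that,
   near w = 0, F(w) / U(1; q) = Q(w) exp(2 S(w) - w/2) with Q(w) = (e^w - 1)/w
   and S(w) = sum_k u_k w^k / k!, so that F is analytic there whatever the
   convergence of U, and (zeta d/dzeta)^n U at zeta = 1 is the n-th derivative
   of F at 0.  Since Q'/Q = 1 + sum_(n >= 0) B_(n+1) w^n / (n+1)!, the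
   logarithmic derivative of F has the Taylor coefficients
   2 u_(n+1) + B_(n+1)/(n+1), which are 2 W_(n+1), for n >= 1; those of even
   index n vanish because U(1/zeta) = U(zeta) (reversing a unimodal sequence
   negates its rank).  Hence y_k = U_2k / (2k)! and x_k = 2 W_2k / (2k)! satisfy
   k y_k = sum_j j x_j y_(k-j), i.e. 1 + sum y_k t^k = exp (sum x_k t^k), and the
   two traces are the coefficients of t^k in this exponential and in the inverse
   logarithm, expanded by the multinomial theorem. *)

Require Import Defs.
From HB Require Import structures.
From mathcomp Require Import all_boot all_order all_algebra.
From mathcomp Require Import complex.
From mathcomp Require Import all_classical all_reals all_analysis.
From mathcomp Require Import ring lra.
Set Implicit Arguments.
Unset Strict Implicit.
Unset Printing Implicit Defensive.
Import Order.TTheory GRing.Theory Num.Theory.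
Import numFieldNormedType.Exports.
Local Open Scope ring_scope.
Local Open Scope classical_set_scope.

(** * Complex power series *)

Section Norm.
Variable R : realType.
Local Notation C := (Cplx R).
Implicit Types z w : C.

(** The norm of [Cplx R] takes its values in [Cplx R] itself; a modulus with values in [R] gives
    access to the real order and to [lra]. *)
Definition cabs z : R := ComplexField.Normc.normc (z : R[i]).

Lemma normE z : `|z| = real_complex R (cabs z) :> C.
Proof. by []. Qed.

Lemma cabsM z w : cabs (z * w) = cabs z * cabs w.
Proof. exact: ComplexField.Normc.normcM. Qed.

Lemma cabsD z w : cabs (z + w) <= cabs z + cabs w.
Proof. exact: le_normcD. Qed.

Lemma cabs0 : cabs 0 = 0. Proof. exact: ComplexField.Normc.normc0. Qed.
Lemma cabs1 : cabs 1 = 1. Proof. exact: ComplexField.Normc.normc1. Qed.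
Lemma cabsN z : cabs (- z) = cabs z. Proof. exact: normcN. Qed.
Lemma cabsB z w : cabs (z - w) = cabs (w - z). Proof. by rewrite -cabsN opprB. Qed.
Lemma cabs_ge0 z : 0 <= cabs z.
Proof. by case: z => a b; rewrite /cabs /= sqrtr_ge0. Qed.
Lemma cabs_eq0 z : (cabs z == 0) = (z == 0).
Proof.
apply/eqP/eqP => [|->]; [exact: ComplexField.Normc.eq0_normc|exact: cabs0].
Qed.
Lemma cabs_gt0 z : (0 < cabs z) = (z != 0).
Proof. by rewrite lt_neqAle cabs_ge0 andbT eq_sym cabs_eq0. Qed.
Lemma cabsX z n : cabs (z ^+ n) = cabs z ^+ n.
Proof. by elim: n => [|n ih]; rewrite ?cabs1// !exprS cabsM ih. Qed.
Lemma cabsV z : cabs z^-1 = (cabs z)^-1.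
Proof. exact: ComplexField.Normc.normcV. Qed.
Lemma cabs_real (x : R) : cabs (real_complex R x) = `|x|.
Proof. by rewrite /cabs /= expr0n addr0 sqrtr_sqr. Qed.
Lemma cabs_Re z : `|complex.Re z| <= cabs z.
Proof.
case: z => a b; rewrite /cabs /= -sqrtr_sqr ler_wsqrtr// lerDl sqr_ge0//.
Qed.
Lemma cabs_Im z : `|complex.Im z| <= cabs z.
Proof.
case: z => a b; rewrite /cabs /= -sqrtr_sqr ler_wsqrtr// lerDr sqr_ge0//.
Qed.
Lemma cabs_ReIm z : cabs z <= `|complex.Re z| + `|complex.Im z|.
Proof.
case: z => a b; rewrite {1}(_ : Complex a b = real_complex R a + real_complex R b * Complex 0 1).
  apply: (le_trans (cabsD _ _)); rewrite cabsM !cabs_real /=.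
  by rewrite expr0n expr1n add0r sqrtr1 mulr1.
by apply/eqP; rewrite eq_complex /=; apply/andP; split; apply/eqP; ring.
Qed.
Lemma cabs_nat n : cabs n%:R = n%:R.
Proof. by rewrite -(rmorph_nat (real_complex R)) cabs_real normr_nat. Qed.
Lemma cabs_sum n (f : nat -> C) : cabs (\sum_(0 <= i < n) f i) <= \sum_(0 <= i < n) cabs (f i).
Proof.
elim: n => [|n ih]; first by rewrite !big_nil cabs0.
by rewrite !big_nat_recr//=; apply: le_trans (cabsD _ _) _; rewrite lerD2r.
Qed.

(** Balls of [Cplx R] have complex radii; a positive one equals its real part. *)
Lemma cabs_nbhsP (z : C) (P : C -> Prop) :
  (\forall w \near z, P w) <-> exists2 e : R, 0 < e & forall w, cabs (w - z) < e -> P w.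
Proof.
split.
  move=> /nbhs_ballP[e /= e0 eP].
  have eE : e = real_complex R (complex.Re e) by rewrite RRe_real// gtr0_real.
  exists (complex.Re e).
    by move: e0; rewrite eE -[0]/(real_complex R 0) ltcR.
  move=> w wz; apply: eP; rewrite /ball/= normE eE ltcR/=.
  by rewrite cabsB.
move=> [e e0 eP]; apply/nbhs_ballP; exists (real_complex R e) => /=.
  by rewrite -[0]/(real_complex R 0) ltcR.
by move=> w; rewrite /ball/= normE ltcR cabsB => /eP.
Qed.

Lemma cabs_cvgP T (F : set_system T) (FF : Filter F) (f : T -> C) (l : C) :
  (f x @[x --> F] --> l) <-> (forall e : R, 0 < e -> \forall x \near F, cabs (f x - l) < e).
Proof.
split.
  move=> /cvgrPdist_lt H e e0.
  have : 0 < real_complex R e :> C by rewrite -[0]/(real_complex R 0) ltcR.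
  by move=> /H; apply: filterS => x; rewrite normE ltcR cabsB.
move=> H; apply/cvgrPdist_lt => e e0.
have eE : e = real_complex R (complex.Re e) by rewrite RRe_real// gtr0_real.
have : 0 < complex.Re e by move: e0; rewrite eE -[0]/(real_complex R 0) ltcR.
by move=> /H; apply: filterS => x; rewrite eE normE ltcR cabsB.
Qed.

Lemma cvg_ReIm (u : nat -> C) (a b : R) :
  (fun n => complex.Re (u n)) @ \oo --> a -> (fun n => complex.Im (u n)) @ \oo --> b ->
  u @ \oo --> (Complex a b : C).
Proof.
move=> /cvgrPdist_lt ua /cvgrPdist_lt ub; apply/cabs_cvgP => e e0.
have e2 : 0 < e / 2 by rewrite divr_gt0.
near=> n; apply: (le_lt_trans (cabs_ReIm _)).
rewrite (splitr e) ltrD//.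
  have : `|a - complex.Re (u n)| < e / 2 by near: n; exact: ua.
  by case: (u n) => x y /=; rewrite distrC.
have : `|b - complex.Im (u n)| < e / 2 by near: n; exact: ub.
by case: (u n) => x y /=; rewrite distrC.
Unshelve. all: by end_near. Qed.

Lemma cabs_lim_le (u : nat -> C) (l : C) (B : R) :
  (\forall n \near \oo, cabs (u n) <= B) -> u @ \oo --> l -> cabs l <= B.
Proof.
move=> uB /cabs_cvgP ul; apply/ler_addgt0Pr => e e0.
have [n [uBn ule]] : exists n, cabs (u n) <= B /\ cabs (u n - l) < e.
  by apply: (@filter_ex _ \oo); near=> n; split; near: n; [|exact: ul].
rewrite -(subrK (u n) l); apply: le_trans (cabsD _ _) _.
by rewrite addrC lerD// cabsB ltW.
Unshelve. all: by end_near. Qed.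

End Norm.

(** * Radius of convergence and termwise differentiation *)

Section PS.
Variable R : realType.
Local Notation C := (Cplx R).
Implicit Types (z w h : C) (a : nat -> C) (r rho : R).

(* The power series with coefficients [a] has radius of convergence at least [r]. *)
Definition has_radius a r :=
  forall rho, 0 <= rho < r -> exists M : R, forall n, cabs (a n) * rho ^+ n <= M.

Definition diffs a : nat -> C := fun n => n.+1%:R * a n.+1.

Definition psum a z : C := limn (fun N => \sum_(0 <= n < N) a n * z ^+ n).

(** By induction n x^n (1 - x) <= 1 - x^n: each of the n terms of 1 + x + ... + x^(n-1) is at least
    x^n. *)
Lemma nxn_bound (x : R) n : 0 <= x < 1 -> n%:R * x ^+ n <= (1 - x)^-1.
Proof.
move=> /andP[x0 x1]; have x1' : 0 < 1 - x by lra.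
rewrite -[leRHS]mul1r ler_pdivlMr//.
apply: (@le_trans _ _ (1 - x ^+ n)); last by rewrite lerBlDr lerDl exprn_ge0.
elim: n => [|n ih]; first by rewrite expr0 !mul0r subrr.
have xn : x ^+ n.+1 * (1 - x) <= 1 - x.
  by rewrite ler_piMl ?(ltW x1')// exprn_ile1// ltW.
have := ler_wpM2l x0 ih.
by rewrite -natr1 !exprS in xn *; move: (x ^+ n) xn => y xn; nra.
Qed.

(** With s strictly between [rho] and [r], the values |a_n| s^n are bounded, and so are n (rho/s)^n
    by [nxn_bound]. *)
Lemma radius_mul a r : has_radius a r -> has_radius (fun n => n%:R * a n) r.
Proof.
move=> ga rho /andP[rho0 rhor]; pose s := (rho + r) / 2.
have s0 : 0 < s by rewrite /s; lra.
have [M aM] : exists M : R, forall n, cabs (a n) * s ^+ n <= M.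
  by apply: ga; rewrite /s; lra.
exists (M * (1 - rho / s)^-1) => n.
have x01 : 0 <= rho / s < 1.
  by rewrite divr_ge0 ?(ltW s0)//= ltr_pdivrMr// mul1r /s; lra.
rewrite cabsM cabs_nat.
have -> : n%:R * cabs (a n) * rho ^+ n = (cabs (a n) * s ^+ n) * (n%:R * (rho / s) ^+ n).
  rewrite -[in LHS](divfK (lt0r_neq0 s0) rho) exprMn; ring.
apply: ler_pM => //; last exact: nxn_bound.
  by rewrite mulr_ge0 ?cabs_ge0 ?exprn_ge0// ltW.
by rewrite mulr_ge0// exprn_ge0//; case/andP: x01.
Qed.

Lemma radius_shift a r : has_radius a r -> has_radius (fun n => a n.+1) r.
Proof.
move=> ga rho /andP[rho0 rhor]; pose s := (rho + r) / 2.
have s0 : 0 < s by rewrite /s; lra.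
have [M aM] : exists M : R, forall n, cabs (a n) * s ^+ n <= M.
  by apply: ga; rewrite /s; lra.
exists (M / s) => n; rewrite ler_pdivlMr//; apply: le_trans (aM n.+1).
rewrite -mulrA ler_wpM2l ?cabs_ge0// exprSr ler_wpM2r ?(ltW s0)//.
by rewrite lerXn2r ?nnegrE ?(ltW s0)// /s; lra.
Qed.

Lemma radius_diffs a r : has_radius a r -> has_radius (diffs a) r.
Proof. by move=> ga; exact: radius_shift (radius_mul ga). Qed.

Lemma radius_sum a r rho : has_radius a r -> 0 <= rho < r ->
  exists K : R, forall N, \sum_(0 <= n < N) cabs (a n) * rho ^+ n <= K.
Proof.
move=> ga /andP[rho0 rhor]; pose s := (rho + r) / 2.
have s0 : 0 < s by rewrite /s; lra.
have [M aM] : exists M : R, forall n, cabs (a n) * s ^+ n <= M.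
  by apply: ga; rewrite /s; lra.
pose x := rho / s.
have x0 : 0 <= x by rewrite divr_ge0 ?(ltW s0).
have x1 : x < 1 by rewrite ltr_pdivrMr// mul1r /s; lra.
have M0 : 0 <= M by apply: le_trans (aM 0%N); rewrite expr0 mulr1 cabs_ge0.
exists (M * (1 - x)^-1) => N.
apply: (@le_trans _ _ (\sum_(0 <= n < N) M * x ^+ n)).
  apply: ler_sum => n _; rewrite -[in leLHS](divfK (lt0r_neq0 s0) rho) exprMn.
  by rewrite [_ * s ^+ n]mulrC mulrA ler_wpM2r// exprn_ge0.
rewrite -mulr_sumr ler_wpM2l// -[leRHS]mul1r ler_pdivlMr ?subr_gt0//.
have -> : (\sum_(0 <= i < N) x ^+ i) * (1 - x) = 1 - x ^+ N.
  by rewrite big_mkord -[RHS]opprB subrX1; ring.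
by rewrite lerBlDr lerDl exprn_ge0.
Qed.

Lemma real_series_cvg (b : nat -> R) (K : R) :
  (forall N, \sum_(0 <= n < N) `|b n| <= K) -> cvgn (series b).
Proof.
move=> bK; apply: normed_cvg; apply: nondecreasing_is_cvgn.
  by apply/nondecreasing_seqP => n; rewrite -[leLHS]/(\sum_(0 <= i < n) `|b i|)
    -[leRHS]/(\sum_(0 <= i < n.+1) `|b i|) big_nat_recr//= lerDl.
by exists K => _ [n _ <-] /=; exact: bK.
Qed.

Lemma psum_cvg a r z : has_radius a r -> cabs z < r ->
  (fun N => \sum_(0 <= n < N) a n * z ^+ n) @ \oo --> psum a z.
Proof.
move=> ga zr; have [K aK] := radius_sum ga (introT andP (conj (cabs_ge0 z) zr)).
have ReE N : complex.Re (\sum_(0 <= n < N) a n * z ^+ n) =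
    series (fun n => complex.Re (a n * z ^+ n)) N.
  by rewrite /series/=; elim: N => [|N ih]; rewrite ?big_nil// !big_nat_recr//= -ih;
     case: (\sum_(_ <= _ < _) _); case: (_ * _).
have ImE N : complex.Im (\sum_(0 <= n < N) a n * z ^+ n) =
    series (fun n => complex.Im (a n * z ^+ n)) N.
  by rewrite /series/=; elim: N => [|N ih]; rewrite ?big_nil// !big_nat_recr//= -ih;
     case: (\sum_(_ <= _ < _) _); case: (_ * _).
have cR : cvgn (series (fun n => complex.Re (a n * z ^+ n))).
  apply: (real_series_cvg (K := K)) => N; apply: le_trans (aK N); apply: ler_sum => n _.
  by apply: le_trans (cabs_Re _) _; rewrite cabsM cabsX.
have cI : cvgn (series (fun n => complex.Im (a n * z ^+ n))).
  apply: (real_series_cvg (K := K)) => N; apply: le_trans (aK N); apply: ler_sum => n _.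
  by apply: le_trans (cabs_Im _) _; rewrite cabsM cabsX.
have : (fun N => \sum_(0 <= n < N) a n * z ^+ n) @ \oo -->
  (Complex (limn (series (fun n => complex.Re (a n * z ^+ n))))
           (limn (series (fun n => complex.Im (a n * z ^+ n)))) : C).
  by apply: cvg_ReIm; [under eq_fun do rewrite ReE|under eq_fun do rewrite ImE].
by move=> H; rewrite /psum (cvg_lim _ H)//; exact: norm_hausdorff.
Qed.

Lemma psum_unique a z (l : C) :
  (fun N => \sum_(0 <= n < N) a n * z ^+ n) @ \oo --> l -> psum a z = l.
Proof. by move=> H; apply: cvg_lim => //; exact: norm_hausdorff. Qed.

Lemma psum0 a : psum a 0 = a 0%N.
Proof.
apply: psum_unique; apply/cabs_cvgP => e e0; exists 1%N => // -[|n] //= _.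
rewrite big_nat_recl// expr0 mulr1 big1 ?addr0 ?subrr ?cabs0// => i _.
by rewrite expr0n mulr0.
Qed.

(* Both sides carry a factor [rho ^+ 2] to avoid the exponent [n - 2]. *)
Lemma exp_quad z h rho n : 0 <= rho -> cabs z <= rho -> cabs (z + h) <= rho ->
  rho ^+ 2 * cabs ((z + h) ^+ n - z ^+ n - h * (n%:R * z ^+ n.-1)) <=
  cabs h ^+ 2 * (n%:R ^+ 2 * rho ^+ n).
Proof.
move=> rho0 zr zhr; elim: n => [|n ih].
  by rewrite !expr0 subrr mul0r mulr0 subr0 cabs0 expr0n !mul0r !mulr0.
(* Recursion for the remainder: multiply the one of order n by z + h and add h^2 n z^(n-1). The
   bound then closes because n^2 + n <= (n+1)^2. *)
have -> : (z + h) ^+ n.+1 - z ^+ n.+1 - h * (n.+1%:R * z ^+ n.+1.-1) =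
  (z + h) * ((z + h) ^+ n - z ^+ n - h * (n%:R * z ^+ n.-1)) +
   h ^+ 2 * (n%:R * z ^+ n.-1).
  rewrite -natr1; case: n {ih} => [|n] /=; first by rewrite !expr0 !expr1; ring.
  rewrite !exprS -natr1; ring.
have s2 : rho ^+ 2 * cabs (h ^+ 2 * (n%:R * z ^+ n.-1)) <= cabs h ^+ 2 * (n%:R * rho ^+ n.+1).
  rewrite !cabsM !cabsX cabs_nat mulrCA ler_wpM2l ?sqr_ge0//.
  case: n {ih} => [|n]; first by rewrite !mul0r mulr0.
  rewrite mulrCA ler_wpM2l// -[n.+2]/(2 + n)%N exprD ler_wpM2l ?sqr_ge0//.
  by rewrite lerXn2r ?nnegrE ?cabs_ge0.
have s1 : rho ^+ 2 * cabs ((z + h) * ((z + h) ^+ n - z ^+ n - h * (n%:R * z ^+ n.-1)))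
   <= cabs h ^+ 2 * (n%:R ^+ 2 * rho ^+ n.+1).
  rewrite cabsM mulrCA (exprS rho n) [n%:R ^+ 2 * _]mulrCA [X in _ <= X]mulrCA.
  by apply: ler_pM => //; rewrite ?mulr_ge0 ?exprn_ge0 ?cabs_ge0.
apply: (le_trans (ler_wpM2l (exprn_ge0 _ rho0) (cabsD _ _))).
rewrite mulrDr; apply: (le_trans (lerD s1 s2)); rewrite -mulrDr -mulrDl.
rewrite ler_wpM2l ?sqr_ge0// ler_wpM2r ?exprn_ge0//.
by rewrite -natr1; have : 0 <= n%:R :> R by []; nra.
Qed.

Lemma cvg_succ (u : nat -> C) (l : C) : u @ \oo --> l -> (fun n => u n.+1) @ \oo --> l.
Proof. by move=> ul; rewrite cvg_shiftS. Qed.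

(** Summing [exp_quad] against |a_n| bounds the remainder, with K a bound for the sums of n^2 |a_n|
    rho^n. One K serves the whole disc, which yields the derivative of the sum. *)
Lemma psum_quad a r rho : has_radius a r -> 0 <= rho < r ->
  exists K : R, forall z h, cabs z <= rho -> cabs (z + h) <= rho ->
  rho ^+ 2 * cabs (psum a (z + h) - psum a z - h * psum (diffs a) z) <= K * cabs h ^+ 2.
Proof.
move=> ga rr; have /andP[rho0 rhor] := rr.
have [K bK] := radius_sum (radius_mul (radius_mul ga)) rr.
exists K => z h zr zhr.
have c1 := psum_cvg ga (le_lt_trans zhr rhor).
have c2 := psum_cvg ga (le_lt_trans zr rhor).
have c3 := psum_cvg (radius_diffs ga) (le_lt_trans zr rhor).
have cc : (fun N => \sum_(0 <= n < N.+1) a n * (z + h) ^+ n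
      - \sum_(0 <= n < N.+1) a n * z ^+ n
      - h * (\sum_(0 <= n < N) diffs a n * z ^+ n)) @ \oo -->
    psum a (z + h) - psum a z - h * psum (diffs a) z.
  apply: cvgB; last by apply: cvgM; [exact: cvg_cst|exact: c3].
  apply: cvgB.
    exact: (cvg_succ c1).
  exact: (cvg_succ c2).
(* For [rho = 0] the left side vanishes, and K >= 0 follows from its bound on the empty sum;
   otherwise division by rho^2 is allowed. *)
have := rho0; rewrite le_eqVlt => /orP[/eqP <-|rhop].
  rewrite expr0n mul0r mulr_ge0 ?exprn_ge0 ?cabs_ge0//.
  by apply: le_trans (bK 0%N); rewrite big_nil.
rewrite mulrC -ler_pdivlMr ?exprn_gt0//.
apply: (cabs_lim_le _ cc); apply: nearW => N.
rewrite ler_pdivlMr ?exprn_gt0// mulrC.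
have -> : \sum_(0 <= n < N.+1) a n * (z + h) ^+ n - \sum_(0 <= n < N.+1) a n * z ^+ n -
    h * (\sum_(0 <= n < N) diffs a n * z ^+ n) =
  \sum_(0 <= n < N.+1) a n * ((z + h) ^+ n - z ^+ n - h * (n%:R * z ^+ n.-1)).
  rewrite [X in h * X](_ : _ = \sum_(0 <= n < N.+1) a n * (n%:R * z ^+ n.-1)).
    rewrite mulr_sumr -!sumrB; apply: eq_bigr => n _; ring.
  rewrite [RHS]big_nat_recl//= mul0r mulr0 add0r; apply: eq_bigr => n _.
  by rewrite /diffs; ring.
apply: (le_trans (ler_wpM2l (exprn_ge0 _ rho0) (cabs_sum _ _))).
rewrite mulr_sumr mulrC.
apply: le_trans (ler_wpM2l (exprn_ge0 _ (cabs_ge0 h)) (bK N.+1)).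
rewrite mulr_sumr; apply: ler_sum => n _.
rewrite !cabsM cabs_nat mulrCA.
rewrite [leRHS](_ : _ = cabs (a n) * (cabs h ^+ 2 * (n%:R ^+ 2 * rho ^+ n))); last by ring.
by rewrite ler_wpM2l ?cabs_ge0// exp_quad.
Qed.

(** Clearing the denominator of the difference quotient admits h = 0, so increments that vanish
    cause no trouble in the chain rule. *)
Lemma is_deriveP z (f : C -> C) (d : C) : is_derive z 1 f d <->
  (forall e : R, 0 < e -> exists2 del : R, 0 < del &
    forall h, cabs h < del -> cabs (f (z + h) - f z - h * d) <= e * cabs h).
Proof.
have key : (h^-1 *: (f (h *: 1 + z) - f z) @[h --> 0^'] --> d) <->
    (forall e : R, 0 < e -> exists2 del : R, 0 < del &
    forall h, cabs h < del -> cabs (f (z + h) - f z - h * d) <= e * cabs h).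
  have E h : h != 0 ->
      cabs (f (z + h) - f z - h * d) = cabs h * cabs (h^-1 *: (f (h *: 1 + z) - f z) - d).
    move=> h0; rewrite -cabsM mulrBr; congr cabs; congr (_ - _).
    by rewrite [h^-1 *: _]/(h^-1 * _) mulVKf// [h *: 1]mulr1 (addrC h).
  split.
    move=> /cabs_cvgP H e e0; have := H _ e0; rewrite near_withinE => /cabs_nbhsP[del del0 P].
    exists del => // h hd; have [->|h0] := eqVneq h 0.
      by rewrite addr0 subrr mul0r subr0 !cabs0 mulr0.
    rewrite E// mulrC ler_wpM2r ?cabs_ge0// ltW//; apply: P => //.
    by rewrite subr0.
  move=> H; apply/cabs_cvgP => e e0; have e2 : 0 < e / 2 by rewrite divr_gt0.
  have [del del0 P] := H _ e2; rewrite near_withinE; apply/cabs_nbhsP.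
  exists del => // h; rewrite subr0 => /P + h0; rewrite E// mulrC ler_pM2r ?cabs_gt0//.
  by move=> /le_lt_trans; apply; rewrite ltr_pdivrMr// ltr_pMr// ltr1n.
split.
  move=> [df dfE]; apply/key; rewrite -dfE; exact: df.
move=> /key H; split; first by apply/cvg_ex; exists d.
by apply: cvg_lim H; exact: norm_hausdorff.
Qed.

Lemma is_derive_psum a r z : has_radius a r -> cabs z < r ->
  is_derive z 1 (psum a) (psum (diffs a) z).
Proof.
move=> ga zr; apply/is_deriveP => e e0.
have z0 := cabs_ge0 z.
pose rho := (cabs z + r) / 2.
have rho0 : 0 < rho by rewrite /rho; lra.
have rr : 0 <= rho < r by rewrite /rho; lra.
have [K HK] := psum_quad ga rr.
have r2 : 0 < rho ^+ 2 by rewrite exprn_gt0.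
pose K1 := `|K| + 1.
have K1p : 0 < K1 by rewrite ltr_wpDl.
exists (Num.min (rho - cabs z) (e * rho ^+ 2 / K1)).
  rewrite lt_min; apply/andP; split; first by rewrite /rho; lra.
  by apply: divr_gt0 => //; apply: mulr_gt0.
move=> h; rewrite lt_min => /andP[h1 h2].
have H := HK z h; rewrite -(ler_pM2l r2).
apply: (le_trans (H _ _)).
  by rewrite /rho; lra.
  by apply: le_trans (cabsD _ _) _; lra.
rewrite expr2 !mulrA ler_wpM2r ?cabs_ge0//.
apply: (@le_trans _ _ (K1 * cabs h)).
  by rewrite ler_wpM2r ?cabs_ge0// /K1; have := ler_norm K; lra.
by rewrite -ler_pdivlMl// mulrC [_ * e]mulrC ltW.
Qed.

Lemma is_derive_chain (f g : C -> C) z (a b : C) :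
  is_derive z 1 f a -> is_derive (f z) 1 g b -> is_derive z 1 (g \o f) (b * a).
Proof.
move=> /is_deriveP Hf /is_deriveP Hg; apply/is_deriveP => e e0.
have a0 := cabs_ge0 a; have b0 := cabs_ge0 b.
(* The error splits into the outer error at the increment k of f and b times the inner error.
   [e2 <= 1] gives |k| <= (|a| + 1)|h|, so [e1] keeps the first part below e|h|/2, and [e2] does the
   same for the second. *)
pose e1 := e / 2 / (cabs a + 1); pose e2 := Num.min 1 (e / 2 / (cabs b + 1)).
have e10 : 0 < e1 by rewrite !divr_gt0//; lra.
have e20 : 0 < e2 by rewrite lt_min ltr01 /= !divr_gt0//; lra.
have e2_1 : e2 <= 1 by rewrite ge_min lexx.
have e2_2 : (cabs b + 1) * e2 <= e / 2.
  by rewrite mulrC -ler_pdivlMr ?ge_min ?lexx ?orbT//; lra.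
have e1_2 : e1 * (cabs a + 1) = e / 2 by rewrite /e1 divfK//; lra.
have [d1 d10 H1] := Hg _ e10; have [d2 d20 H2] := Hf _ e20.
exists (Num.min d2 (d1 / (cabs a + 1))).
  by rewrite lt_min d20 /= divr_gt0//; lra.
move=> h; rewrite lt_min => /andP[/H2 h2 h1].
have h0 := cabs_ge0 h.
pose k := f (z + h) - f z.
have kE : cabs k <= (cabs a + 1) * cabs h.
  have -> : k = (k - h * a) + h * a by rewrite subrK.
  apply: (le_trans (cabsD _ _)); rewrite cabsM -/k in h2 *.
  by have := ler_wpM2r h0 e2_1; lra.
have kd : cabs k < d1.
  apply: (le_lt_trans kE); move: h1; rewrite ltr_pdivlMr; last by lra.
  by rewrite mulrC.
have kw : f z + k = f (z + h) by rewrite /k; ring.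
have := H1 _ kd; rewrite kw => H3.
rewrite /comp.
have -> : g (f (z + h)) - g (f z) - h * (b * a) =
  (g (f (z + h)) - g (f z) - k * b) + (k - h * a) * b by ring.
apply: (le_trans (cabsD _ _)); rewrite cabsM.
have P1 : e1 * cabs k <= e / 2 * cabs h by rewrite -e1_2 -mulrA ler_wpM2l// ltW.
have P2 : cabs (k - h * a) * cabs b <= e / 2 * cabs h.
  apply: (le_trans (ler_wpM2r b0 h2)); rewrite mulrAC ler_wpM2r//.
  by rewrite mulrDl mul1r in e2_2; lra.
by lra.
Qed.

End PS.

(** * Exponential, logarithm and iterated derivatives *)

Section Exp.
Variable R : realType.
Local Notation C := (Cplx R).
Implicit Types (z w h : C) (a : nat -> C) (r rho : R).

Lemma derM (f g : C -> C) z (a b : C) : is_derive z 1 f a -> is_derive z 1 g b ->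
  is_derive z 1 (fun t => f t * g t) (a * g z + f z * b).
Proof.
move=> df dg; have /is_derive_eq := is_deriveM df dg; apply.
by rewrite addrC; congr (_ + _); exact: mulrC.
Qed.

Lemma derD (f g : C -> C) z (a b : C) : is_derive z 1 f a -> is_derive z 1 g b ->
  is_derive z 1 (fun t => f t + g t) (a + b).
Proof. by move=> df dg; exact: is_deriveD. Qed.

Lemma der_cst (c : C) z : is_derive z 1 (fun=> c) (0 : C).
Proof. exact: is_derive_cst. Qed.

Lemma der_id z : is_derive z 1 (fun t : C => t) (1 : C).
Proof. exact: is_derive_id. Qed.

Lemma der_sum n (f : nat -> C -> C) (d : nat -> C) z :
  (forall i, (i < n)%N -> is_derive z 1 (f i) (d i)) ->
  is_derive z 1 (fun t => \sum_(i < n) f i t) (\sum_(i < n) d i).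
Proof.
elim: n => [|n ih] H.
  by under eq_fun do rewrite big_ord0; rewrite big_ord0; exact: der_cst.
under eq_fun do rewrite big_ord_recr/=; rewrite big_ord_recr/=.
by apply: derD; [apply: ih => i ni; apply: H; exact: ltnW|exact: H].
Qed.

(** The real mean value theorem is applied to t |-> p (g (t z)) on [0, 1]. A 1-Lipschitz p carries
    the zero derivative over to this real function; p will be the real or the imaginary part. *)
Lemma zero_derive_path (p : C -> R) (g : C -> C) z :
  (forall a b : C, `|p a - p b| <= cabs (a - b)) ->
  (forall t : R, 0 <= t <= 1 -> is_derive (real_complex R t * z : C) 1 g (0 : C)) ->
  p (g z) = p (g 0).
Proof.
move=> pL dg.
pose phi (t : R) : R := p (g (real_complex R t * z)).
have dphi (t : R) : 0 <= t <= 1 -> is_derive t 1 phi 0.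
  move=> /dg /is_deriveP H.
  have cv : h^-1 *: (phi (h *: 1 + t) - phi t) @[h --> 0^'] --> (0 : R).
    apply/cvgrPdist_le => e e0.
    have z1 : 0 < cabs z + 1 by have := cabs_ge0 z; lra.
    have e1 : 0 < e / (cabs z + 1) by rewrite divr_gt0.
    have [d d0 {}H] := H _ e1; rewrite near_withinE; apply/nbhs_ballP.
    exists (d / (cabs z + 1)) => /=; first by rewrite divr_gt0.
    move=> h; rewrite /ball/= sub0r normrN => hd h0.
    rewrite sub0r normrN normrM normfV mulrC ler_pdivrMr ?normr_gt0//.
    apply: (le_trans (pL _ _)).
    have hz : cabs (real_complex R h * z) < d.
      rewrite cabsM cabs_real; move: hd; rewrite ltr_pdivlMr//; apply: le_lt_trans.
      by rewrite ler_wpM2l// lerDl.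
    have := H _ hz; rewrite mulr0 subr0 -mulrDl -rmorphD/= [t + h]addrC.
    rewrite [h *: 1]mulr1 => /le_trans; apply; rewrite cabsM cabs_real.
    rewrite [leLHS](_ : _ = e * `|h| * (cabs z / (cabs z + 1))); last by ring.
    by rewrite ler_piMr ?mulr_ge0 ?(ltW e0)// ler_pdivrMr// mul1r lerDl.
  split; first by apply/cvg_ex; exists 0.
  by apply: cvg_lim cv; exact: norm_hausdorff.
have cphi : {within `[0, 1]%classic, continuous phi}.
  apply: derivable_within_continuous => t; rewrite in_itv/= => t01.
  by case: (dphi t t01).
have [|c _] := @MVT_segment R phi (fun=> 0) 0 1 ler01 _ cphi.
  by move=> t; rewrite in_itv/= => /andP[/ltW ? /ltW ?]; apply: dphi; apply/andP.
rewrite mul0r => /eqP; rewrite subr_eq0 => /eqP.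
by rewrite /phi mul1r mul0r.
Qed.

Lemma zero_derive r (g : C -> C) z :
  (forall w, cabs w < r -> is_derive w 1 g (0 : C)) -> cabs z < r -> g z = g 0.
Proof.
move=> dg zr.
have H (t : R) : 0 <= t <= 1 -> is_derive (real_complex R t * z : C) 1 g (0 : C).
  move=> /andP[t0 t1]; apply: dg; rewrite cabsM cabs_real ger0_norm//.
  by apply: le_lt_trans zr; rewrite ler_piMl ?cabs_ge0.
apply/eqP; rewrite eq_complex; apply/andP; split; apply/eqP.
  apply: (@zero_derive_path (@complex.Re R)) => // -[x y] [x' y'].
  exact: (cabs_Re (Complex _ _ : C)).
apply: (@zero_derive_path (@complex.Im R)) => // -[x y] [x' y'].
exact: (cabs_Im (Complex _ _ : C)).
Qed.

Definition efact : nat -> C := fun n => (n`!%:R)^-1.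

Lemma radius_efact r : has_radius efact r.
Proof.
move=> rho /andP[rho0 _]; exists (1 + expR rho) => n.
rewrite cabsV cabs_nat; case: n => [|n].
  by rewrite fact0 invr1 mul1r expr0 lerDl expR_ge0.
by have := expR_ge1Dxn n rho0; rewrite mulrC; lra.
Qed.

Lemma diffs_efact : diffs efact = efact.
Proof.
apply/funext => n; rewrite /diffs /efact factS natrM invfM mulrA divff ?mul1r// pnatr_eq0.
Qed.

Lemma is_derive_efact z : is_derive z 1 (psum efact) (psum efact z).
Proof.
have := is_derive_psum (@radius_efact (cabs z + 1)) (z := z).
by rewrite diffs_efact; apply; rewrite ltrDl.
Qed.

(** The product exp(z + w - t) exp(t) has derivative zero in t; compare its values at t = w and t =
    0. *)
Lemma psum_efactD z w : psum efact (z + w) = psum efact z * psum efact w.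
Proof.
pose g t := psum efact (z + w - t) * psum efact t.
have dg t : cabs t < cabs w + 1 -> is_derive t 1 g (0 : C).
  move=> _; have d1 : is_derive t 1 (fun t => z + w - t : C) (-1 : C).
    by have := derD (der_cst (z + w) t) (is_deriveN (der_id t)); rewrite add0r.
  have := derM (is_derive_chain d1 (is_derive_efact _)) (is_derive_efact t).
  by move=> /is_derive_eq; apply; rewrite /comp; ring.
have := zero_derive dg; rewrite /g => /(_ w).
rewrite addrK subr0 => -> //; last by rewrite ltrDl.
by rewrite psum0 /efact fact0 invr1 mulr1.
Qed.

Lemma psum_efact_real (x : R) : psum efact (real_complex R x) = real_complex R (expR x).
Proof.
apply: psum_unique.
have E N : \sum_(0 <= n < N) efact n * real_complex R x ^+ n =
    real_complex R (series (exp_coeff x) N).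
  rewrite /series/= raddf_sum; apply: eq_bigr => n _.
  by rewrite /exp_coeff/= rmorphM rmorphXn fmorphV rmorph_nat mulrC.
apply: cvg_ReIm.
  by under eq_fun do rewrite E; exact: is_cvg_series_exp_coeff.
by under eq_fun do rewrite E; exact: cvg_cst.
Qed.

Lemma psum_efact_im (y : R) : psum efact (Complex 0 y) = Complex (cos y) (sin y).
Proof.
apply: psum_unique.
(* Even powers of iy are real and odd ones imaginary, which separates the series into those of
   cosine and sine. *)
have pw n : (Complex 0 y : C) ^+ n =
   Complex ((~~ odd n)%:R * (-1) ^+ n./2 * y ^+ n) ((odd n)%:R * (-1) ^+ n.-1./2 * y ^+ n).
  have y2 m : (Complex 0 y : C) ^+ m.*2 = real_complex R ((-1) ^+ m * y ^+ m.*2).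
    have yy : (Complex 0 y : C) * Complex 0 y = real_complex R (- (y * y)).
      by apply/eqP; rewrite eq_complex/=; apply/andP; split; apply/eqP; ring.
    elim: m => [|m ih]; first by rewrite !expr0 mul1r.
    rewrite doubleS !exprS ih mulrA yy -rmorphM; congr (real_complex R _); ring.
  rewrite -(odd_double_half n); case: (odd n); move: n./2 => m.
    rewrite add1n exprS y2/= odd_double/= doubleK.
    by apply/eqP; rewrite eq_complex/= !exprS; apply/andP; split; apply/eqP; ring.
  rewrite add0n y2 odd_double/= doubleK.
  by apply/eqP; rewrite eq_complex/=; apply/andP; split; apply/eqP; ring.
have E N : \sum_(0 <= n < N) efact n * (Complex 0 y : C) ^+ n =
   Complex (series (cos_coeff y) N) (series (sin_coeff y) N).
  rewrite /series/=; elim: N => [|N ih]; first by rewrite !big_nil.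
  rewrite !big_nat_recr//= ih pw.
  rewrite /efact -(rmorph_nat (real_complex R)) -fmorphV.
  rewrite /cos_coeff /sin_coeff/=; apply/eqP; rewrite eq_complex/=.
  apply/andP; split; apply/eqP; congr (_ + _).
    by rewrite mul0r subr0 mulrC.
  by rewrite mul0r addr0 mulrC.
apply: cvg_ReIm.
  under eq_fun do rewrite E; rewrite cos.unlock; exact: is_cvg_series_cos_coeff.
under eq_fun do rewrite E; rewrite sin.unlock; exact: is_cvg_series_sin_coeff.
Qed.
End Exp.

(** * Binomial convolution and the derivatives of an exponential *)

Section Conv.
Variable A : comNzRingType.
Implicit Types f g : nat -> A.

(* Binomial convolution: the Leibniz rule for the sequence of derivatives of a product. *)
Definition bconv f g n : A := \sum_(i < n.+1) 'C(n, i)%:R * f i * g (n - i)%N.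

Lemma bconvC f g n : bconv f g n = bconv g f n.
Proof.
rewrite /bconv (reindex_inj rev_ord_inj)/=; apply: eq_bigr => i _.
have ni : (i <= n)%N by rewrite -ltnS.
by rewrite subSS bin_sub// subKn// mulrAC.
Qed.

(** Pascal's rule. Read on derivatives, it differentiates a product once: (fg)' = f'g + fg'. *)
Lemma bconv_shift f g n :
  bconv f g n.+1 = bconv (fun i => f i.+1) g n + bconv f (fun i => g i.+1) n.
Proof.
rewrite /bconv big_ord_recl bin0.
under eq_bigr => i _ do rewrite lift0 binS natrD 2!mulrDl subSS.
rewrite big_split/= addrA addrC; congr (_ + _).
rewrite [RHS]big_ord_recl bin0 !subn0 big_ord_recr/= bin_small// !mul0r addr0; congr (_ + _).
apply: eq_bigr => i _; rewrite -[bump 0 i]/i.+1; congr (_ * _ * g _).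
by rewrite subnSK.
Qed.

(* If [g] lists the derivatives of phi' at a point and [c] is the value of e^phi
   there, then [bexp g c] lists the derivatives of e^phi. *)
Fixpoint bexp_upto (g : nat -> A) (c : A) n : seq A :=
  if n is n'.+1 then
    let s := bexp_upto g c n' in
    rcons s (\sum_(i < n) 'C(n', i)%:R * g i * s`_(n' - i))
  else [:: c].

Definition bexp g c n := (bexp_upto g c n)`_n.

Lemma size_bexp_upto g c n : size (bexp_upto g c n) = n.+1.
Proof. by elim: n => //= n ih; rewrite size_rcons ih. Qed.

Lemma nth_bexp_upto g c n i : (i <= n)%N -> (bexp_upto g c n)`_i = bexp g c i.
Proof.
elim: n => [|n ih]; first by rewrite leqn0 => /eqP ->.
rewrite leq_eqVlt => /orP[/eqP -> //|]; rewrite ltnS => ni.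
by rewrite /= nth_rcons size_bexp_upto ltnS ni ih.
Qed.

Lemma bexp0 g c : bexp g c 0 = c. Proof. by []. Qed.

Lemma bexpS g c n : bexp g c n.+1 = bconv g (bexp g c) n.
Proof.
rewrite /bexp/= nth_rcons size_bexp_upto ltnn eqxx.
by apply: eq_bigr => i _; rewrite nth_bexp_upto// leq_subr.
Qed.

End Conv.

(** * Complex exponential, logarithm near 1, and towers of derivatives *)

Section Tower.
Variable R : realType.
Local Notation C := (Cplx R).
Implicit Types (z w h : C) (a : nat -> C) (r rho : R) (F G : nat -> C -> C).

Lemma cexpE z : cexp z = psum (@efact R) z.
Proof.
case: z => x y; have -> : Complex x y = real_complex R x + Complex 0 y :> C.
  by apply/eqP; rewrite eq_complex/= addr0 add0r !eqxx.
rewrite psum_efactD psum_efact_real psum_efact_im.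
apply/eqP; rewrite eq_complex /cexp/=; apply/andP; split; apply/eqP.
  by rewrite addr0 add0r mul0r subr0.
by rewrite addr0 add0r mul0r addr0.
Qed.

Lemma cexpD z w : cexp (z + w) = cexp z * cexp w.
Proof. by rewrite !cexpE psum_efactD. Qed.

Lemma cexp0 : cexp (0 : C) = 1.
Proof. by rewrite cexpE psum0 /efact fact0 invr1. Qed.

Lemma cexpK z : cexp z * cexp (- z) = 1.
Proof. by rewrite -cexpD subrr cexp0. Qed.

Lemma cexpN z : cexp (- z) = (cexp z)^-1.
Proof.
have := cexpK z; have [->|h] := eqVneq (cexp z) 0.
  by rewrite mul0r => /eqP; rewrite eq_sym oner_eq0.
by move=> e; apply: (mulfI h); rewrite e mulfV.
Qed.

Lemma is_derive_cexp z : is_derive z 1 (@cexp R) (cexp z).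
Proof.
have -> : @cexp R = psum (@efact R) by apply/funext => w; exact: cexpE.
exact: is_derive_efact.
Qed.

Definition logcoef n : C := if n is m.+1 then (-1) ^+ m / m.+1%:R else 0.
(* Meaningful only for [cabs (z - 1) < 1]. *)
Definition clog z : C := psum logcoef (z - 1).

Lemma diffs_logcoef n : diffs logcoef n = (-1) ^+ n.
Proof. by rewrite /diffs/= mulrC divfK// pnatr_eq0. Qed.

Lemma cabs_signr n : cabs ((-1) ^+ n : C) = 1.
Proof. by rewrite cabsX cabsN cabs1 expr1n. Qed.

Lemma radius_logcoef : has_radius logcoef 1.
Proof.
move=> rho /andP[r0 r1]; exists 1 => n; apply: mulr_ile1; rewrite ?cabs_ge0 ?exprn_ge0//.
  case: n => [|n]; first by rewrite cabs0.
  by rewrite cabsM cabs_signr mul1r cabsV cabs_nat invf_le1// ler1n.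
by rewrite exprn_ile1// ltW.
Qed.

(** The geometric series: splitting off its first term gives p = 1 - z p. *)
Lemma psum_alternating z : cabs z < 1 -> psum (diffs logcoef) z * (1 + z) = 1.
Proof.
move=> z1; have c := psum_cvg (radius_diffs radius_logcoef) z1.
have c1 := cvg_succ c.
have c2 : (fun N => \sum_(0 <= n < N.+1) diffs logcoef n * z ^+ n) @ \oo -->
   1 - z * psum (diffs logcoef) z.
  have E N : \sum_(0 <= n < N.+1) diffs logcoef n * z ^+ n =
     1 - z * \sum_(0 <= n < N) diffs logcoef n * z ^+ n.
    rewrite big_nat_recl//= diffs_logcoef !expr0 mul1r; congr (_ + _).
    rewrite mulr_sumr -sumrN; apply: eq_bigr => n _; rewrite !diffs_logcoef !exprS; ring.
  under eq_fun do rewrite E.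
  by apply: cvgB; [exact: cvg_cst|apply: cvgM; [exact: cvg_cst|exact: c]].
have := cvg_unique (@norm_hausdorff _ _) c1 c2.
move: (psum _ _) => p e; rewrite mulrDr mulr1 {1}e; ring.
Qed.

Lemma cabs_lt1 z : cabs z < 1 -> 1 + z != 0.
Proof.
apply: contraTneq => /eqP; rewrite addrC addr_eq0 => /eqP ->.
by rewrite cabsN cabs1 ltxx.
Qed.

Lemma is_derive_logsum z : cabs z < 1 -> is_derive z 1 (psum logcoef) (1 + z)^-1.
Proof.
move=> z1; apply: is_derive_eq (is_derive_psum radius_logcoef z1) _.
by apply: (mulIf (cabs_lt1 z1)); rewrite psum_alternating// mulVf// cabs_lt1.
Qed.

Lemma is_derive_clog z : cabs (z - 1) < 1 -> is_derive z 1 clog z^-1.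
Proof.
move=> z1; have d1 : is_derive z 1 (fun t => t - 1 : C) (1 : C).
  by have := derD (der_id z) (der_cst (-1) z); rewrite addr0.
have := is_derive_chain d1 (is_derive_logsum z1).
by rewrite mulr1 addrC subrK.
Qed.

Lemma clog1 : clog 1 = 0.
Proof. by rewrite /clog subrr psum0. Qed.

(** The function (1 + t) exp(-log(1 + t)) has derivative zero on the unit disc and value 1 at t =
    0. *)
Lemma cexp_clog z : cabs (z - 1) < 1 -> cexp (clog z) = z.
Proof.
move=> z1; pose g t : C := (1 + t) * cexp (- psum logcoef t).
have dg t : cabs t < 1 -> is_derive t 1 g (0 : C).
  move=> t1.
  have d1 : is_derive t 1 (fun t => 1 + t : C) (1 : C).
    by have := derD (der_cst 1 t) (der_id t); rewrite add0r.
  have := derM d1 (is_derive_chain (is_deriveN (is_derive_logsum t1)) (is_derive_cexp _)).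
  move=> /is_derive_eq; apply; rewrite mul1r mulrN mulrN mulrCA divff ?mulr1 ?subrr//.
  exact: cabs_lt1.
have zz : 1 + (z - 1) = z by ring.
have := zero_derive dg z1; rewrite /g psum0 oppr0 cexp0 addr0 mulr1 zz -/(clog z).
by move=> e; rewrite -[LHS]mul1r -e -mulrA [X in _ * X]mulrC cexpK mulr1.
Qed.

Lemma clog_small r : 0 < r -> exists2 d : R, 0 < d &
  forall z, cabs (z - 1) < d -> cabs (z - 1) < 1 /\ cabs (clog z) < r.
Proof.
move=> r0; have := is_derive_clog (z := 1); rewrite subrr cabs0 ltr01 => /(_ isT).
move=> /is_deriveP/(_ _ ltr01)[d d0 H].
(* [clog] has value 0 and derivative 1 at 1, so |clog z - (z - 1)| <= |z - 1| near 1 and |clog z| <=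
   2|z - 1|; this explains r/2. *)
exists (Num.min d (Num.min 1 (r / 2))).
  by rewrite !lt_min d0 ltr01 divr_gt0.
move=> z; rewrite !lt_min => /and3P[/H].
have -> : 1 + (z - 1) = z by ring.
rewrite clog1 subr0 invr1 mulr1 mul1r.
move=> h1 h2 h3; split=> //; rewrite -(subrK (z - 1) (clog z)).
by apply: (le_lt_trans (cabsD _ _)); lra.
Qed.

(* [F n] is the n-th complex derivative of [F 0] on the disc of radius [r]. *)
Definition tower r F := forall n z, cabs z < r -> is_derive z 1 (F n) (F n.+1 z).

Lemma tower_psum a r : has_radius a r -> tower r (fun n => psum (iter n (@diffs R) a)).
Proof.
move=> ga n z zr; apply: (is_derive_psum _ zr).
by elim: n => //= n ih; exact: radius_diffs.
Qed.

Lemma psum_iter_diffs0 a n : psum (iter n (@diffs R) a) 0 = n`!%:R * a n.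
Proof.
(* The induction on n needs every coefficient m; the claim is the case m = 0. *)
rewrite psum0; have E m : iter n (@diffs R) a m * m`!%:R = (n + m)`!%:R * a (n + m)%N.
  elim: n m => [|n ih] m; first by rewrite add0n mulrC.
  rewrite /= /diffs mulrAC [_ * _`!%:R]mulrC -natrM [(_ * m.+1)%N]mulnC -factS.
  by rewrite mulrC ih addnS addSn.
by have := E 0%N; rewrite addn0 fact0 mulr1.
Qed.

Lemma der_bconv F G n z :
  (forall i, (i <= n)%N -> is_derive z 1 (F i) (F i.+1 z)) ->
  (forall i, (i <= n)%N -> is_derive z 1 (G i) (G i.+1 z)) ->
  is_derive z 1 (fun t => bconv (F ^~ t) (G ^~ t) n) (bconv (F ^~ z) (G ^~ z) n.+1).
Proof.
move=> dF dG; rewrite bconv_shift /bconv -big_split/=.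
apply: (@der_sum _ n.+1 (fun i t => 'C(n, i)%:R * F i t * G (n - i)%N t)
  (fun i => 'C(n, i)%:R * F i.+1 z * G (n - i)%N z + 'C(n, i)%:R * F i z * G (n - i).+1 z)).
move=> i ni.
have := derM (derM (der_cst 'C(n, i)%:R z) (dF i ni)) (dG (n - i)%N (leq_subr _ _)).
by move=> /is_derive_eq; apply; rewrite mul0r add0r.
Qed.

Lemma tower_bconv r F G : tower r F -> tower r G ->
  tower r (fun n z => bconv (F ^~ z) (G ^~ z) n).
Proof. by move=> tF tG n z zr; apply: der_bconv => i _; [exact: tF|exact: tG]. Qed.

(** From e' = G_0 e, the Leibniz rule gives each further derivative of e in terms of all lower ones,
    hence the strong induction. *)
Lemma tower_bexp r G (e : C -> C) : tower r G ->
  (forall z, cabs z < r -> is_derive z 1 e (G 0%N z * e z)) ->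
  tower r (fun n z => bexp (G ^~ z) (e z) n).
Proof.
move=> tG de n z zr; elim/ltn_ind: n => -[|n] ih.
  rewrite bexpS /bconv big_ord1 bin0 mul1r subnn bexp0.
  by have := de z zr.
rewrite bexpS; under eq_fun do rewrite bexpS.
have dE i : (i <= n)%N -> is_derive z 1 (fun t => bexp (G ^~ t) (e t) i) (bexp (G ^~ z) (e z) i.+1).
  exact: ih.
exact: (der_bconv (F := G) (G := fun n z => bexp (G ^~ z) (e z) n) (fun i _ => tG i z zr) dE).
Qed.

(** Each differentiation of F_n(-z) brings out one sign. At z = 0 this forces the derivatives of odd
    order to vanish. *)
Lemma tower_even r F : tower r F -> (forall z, cabs z < r -> F 0%N (- z) = F 0%N z) ->
  forall n z, cabs z < r -> F n (- z) = (-1) ^+ n * F n z.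
Proof.
move=> tF even; elim=> [|n ih] z zr; first by rewrite even// mul1r.
have zr' : cabs (- z) < r by rewrite cabsN.
have d1 := is_derive_chain (is_deriveN (der_id z)) (tF n _ zr').
have d2 := derM (der_cst ((-1) ^+ n) z) (tF n z zr).
have nE : \forall t \near z, F n (- t) = (-1) ^+ n * F n t.
  apply/cabs_nbhsP; exists (r - cabs z); first by rewrite subr_gt0.
  move=> w wz; apply: ih; rewrite -(subrK z w).
  by apply: (le_lt_trans (cabsD _ _)); lra.
have [_ e1] := near_eq_is_derive nE d1; have [_ e2] := d2.
move: e1; rewrite e2 mul0r add0r mulrN1 => e.
by rewrite exprS mulN1r mulNr e opprK.
Qed.

(** Under z = e^w the operator z d/dz becomes d/dw. The identity is carried on a whole disc around
    1, since the next derivative needs it in a neighbourhood. *)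
Lemma theta_tower r F (U : C -> C) : 0 < r -> tower r F ->
  (forall w, cabs w < r -> U (cexp w) = F 0%N w) ->
  exists2 d : R, 0 < d & forall k z, cabs (z - 1) < d ->
  iter k (fun (f : C -> C) z => z * derive1 f z) U z = F k (clog z).
Proof.
move=> r0 tF UF; have [d d0 H] := clog_small r0; exists d => //.
elim=> [|k ih] z zd; have [z1 zr] := H _ zd.
  by rewrite /= -UF// cexp_clog.
have z0 : z != 0 by have := cabs_lt1 z1; rewrite addrC subrK.
have dF := is_derive_chain (is_derive_clog z1) (tF k _ zr).
set f := iter k _ U in ih *.
have nE : \forall t \near z, (F k \o clog) t = f t.
  apply/cabs_nbhsP; exists (d - cabs (z - 1)); first by rewrite subr_gt0.
  move=> w wz; rewrite ih// -(subrK z w) -addrA.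
  by apply: (le_lt_trans (cabsD _ _)); lra.
have [_ e] := near_eq_is_derive nE dF.
by rewrite iterS -/f derive1E e mulrC divfK.
Qed.

End Tower.

Section BconvAlg.
Variable A : comNzRingType.
Implicit Types f g h : nat -> A.

Lemma eq_bconv f f' g g' : f =1 f' -> g =1 g' -> bconv f g =1 bconv f' g'.
Proof. by move=> ff gg n; apply: eq_bigr => i _; rewrite ff gg. Qed.

Lemma bconvDl f g h n : bconv (fun i => f i + g i) h n = bconv f h n + bconv g h n.
Proof. by rewrite -big_split; apply: eq_bigr => i _; rewrite mulrDr mulrDl. Qed.

Lemma bconvDr f g h n : bconv f (fun i => g i + h i) n = bconv f g n + bconv f h n.
Proof. by rewrite -big_split; apply: eq_bigr => i _; rewrite mulrDr. Qed.

Lemma bconvA f g h n : bconv f (bconv g h) n = bconv (bconv f g) h n.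
Proof.
elim: n f g h => [|n ih] f g h.
  by rewrite /bconv !big_ord1 /= bin0 !mul1r mulrA.
rewrite !bconv_shift (eq_bconv (fun _ => erefl) (bconv_shift g h)).
rewrite (eq_bconv (bconv_shift f g) (fun _ => erefl)).
by rewrite bconvDl bconvDr !ih addrA.
Qed.

End BconvAlg.

(** * The expansion of the rank generating function *)

Section Bernoulli.

Lemma size_bernoulli_upto n : size (bernoulli_upto n) = n.+1.
Proof. by elim: n => //= n ih; rewrite size_rcons ih. Qed.

Lemma nth_bernoulli_upto n i : (i <= n)%N -> (bernoulli_upto n)`_i = bernoulli_number i.
Proof.
elim: n => [|n ih]; first by rewrite leqn0 => /eqP ->.
rewrite leq_eqVlt => /orP[/eqP -> //|]; rewrite ltnS => ni.
by rewrite /= nth_rcons size_bernoulli_upto ltnS ni ih.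
Qed.

Lemma bernoulli_sum n : \sum_(k < n.+2) 'C(n.+2, k)%:R * bernoulli_number k = 0.
Proof.
rewrite big_ord_recr/= /bernoulli_number/= nth_rcons size_bernoulli_upto ltnn eqxx.
rewrite binSn mulNr mulrN mulrCA divff ?pnatr_eq0// mulr1.
apply/eqP; rewrite subr_eq0; apply/eqP; apply: eq_bigr => i _.
by rewrite -/(bernoulli_number i) -(@nth_bernoulli_upto n i) -1?ltnS.
Qed.

Variable F : numFieldType.

Definition cothK i : F := (i == 0)%:R + ratr (bernoulli_number i.+1) / i.+1%:R.

(* [cothK] lists the derivatives at 0 of Q'/Q for Q = (e^w - 1)/w, and
   [n |-> 1/(n+1)] those of Q. *)
Lemma inv_succ_bconv n : (n.+2%:R)^-1 = bconv cothK (fun i => (i.+1%:R)^-1) n.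
Proof.
rewrite bconvDl.
have -> : bconv (fun i => (i == 0)%:R) (fun i => (i.+1%:R)^-1 : F) n = (n.+1%:R)^-1.
  rewrite /bconv big_ord_recl big1 ?addr0 ?bin0 ?mul1r ?subn0// => i _.
  by rewrite mulr0 mul0r.
have n1 : (n.+1%:R : F) != 0 by rewrite pnatr_eq0.
have n2 : (n.+2%:R : F) != 0 by rewrite pnatr_eq0.
have -> : bconv (fun i => ratr (bernoulli_number i.+1) / i.+1%:R) (fun i => (i.+1%:R)^-1 : F) n =
   (n.+1%:R * n.+2%:R)^-1 * ratr (\sum_(i < n.+1) 'C(n.+2, i.+1)%:R * bernoulli_number i.+1).
  rewrite /bconv rmorph_sum mulr_sumr; apply: eq_bigr => i _.
  have ni : (i <= n)%N by rewrite -ltnS.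
  rewrite rmorphM rmorph_nat/=.
  have i1 : (i.+1%:R : F) != 0 by rewrite pnatr_eq0.
  have i2 : ((n - i).+1%:R : F) != 0 by rewrite pnatr_eq0.
  (* This turns the coefficients of the convolution into those of the Bernoulli recursion. *)
  have E : n.+1%:R * n.+2%:R * 'C(n, i)%:R = i.+1%:R * (n - i).+1%:R * 'C(n.+2, i.+1)%:R :> F.
    rewrite -!natrM; congr (_%:R).
    have e1 := mul_bin_diag n.+2 i; have e2 := mul_bin_down n.+1 i.
    by rewrite [LHS](_ : _ = n.+2 * (n.+1 * 'C(n, i)))%N; [rewrite e2 subSn// mulnCA e1; ring|ring].
  move: (ratr _) E i1 i2 => b; move: n1 n2; move: (n.+1%:R) (n.+2%:R) (i.+1%:R).
  move: ((n - i).+1%:R) ('C(n, i)%:R) ('C(n.+2, i.+1)%:R) => t c d p q s p0 q0 E s0 t0.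
  have -> : c = s * t * d / (p * q) by rewrite -E; field; rewrite p0 q0.
  by field; rewrite p0 q0 s0 t0.
(* The Bernoulli recursion with its term B_0 = 1 moved across. What remains is 1/(n+1) -
   1/((n+1)(n+2)) = 1/(n+2). *)
have -> : \sum_(i < n.+1) 'C(n.+2, i.+1)%:R * bernoulli_number i.+1 = -1 :> rat.
  have := bernoulli_sum n; rewrite big_ord_recl bin0 mul1r => /eqP.
  by rewrite addrC addr_eq0 => /eqP <-.
rewrite rmorphN rmorph1 mulrN1.
have -> : n.+2%:R = n.+1%:R + 1 :> F by rewrite natr1.
have : n.+1%:R + 1 != 0 :> F by rewrite natr1.
by move: (n.+1%:R) n1 => p p0 p1; field; rewrite p0 p1.
Qed.

End Bernoulli.

(** * Symmetry of the rank under reversal *)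

Section Symmetry.

Let T n : Type := n.-bseq 'I_n.+1 * 'I_n.+1 * n.-bseq 'I_n.+1.

Let P m n (t : T n) : bool :=
  let a := map val t.1.1 in let c := val t.1.2 in let b := map val t.2 in
  [&& weakly_unimodal a c b, (sumn a + c + sumn b == n)%N &
      (size a)%:Z - (size b)%:Z == m].

Lemma unimodal_countE m n : unimodal_count m n = #|finset (P m (n := n))|.
Proof. by apply: eq_card => t; rewrite !inE; apply/idP/idP; rewrite inE. Qed.

(** Reversal sends (a, c, b) to (rev b, c, rev a): an involution that preserves the weight and
    negates the rank. *)
Lemma unimodal_countN (m : int) n : unimodal_count (- m) n = unimodal_count m n.
Proof.
pose f (t : T n) := (([bseq of rev t.2], t.1.2), [bseq of rev t.1.1]) : T n.
have fK : involutive f.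
  by move=> [[a c] b]; congr (_, _, _); apply: val_inj; rewrite /= revK.
rewrite !unimodal_countE -[RHS](card_preimset _ (inv_inj fK)).
apply: eq_card => -[[a c] b]; rewrite !inE /P /= !map_rev /weakly_unimodal.
rewrite !mem_rev !sumn_rev !size_rev.
rewrite -rev_cons -rev_rcons !rev_sorted.
rewrite -[sorted (fun z => leq^~ z) _]/(sorted geq _) -[sorted (fun z => geq^~ z) _]/(sorted leq _).
rewrite -eqr_opp opprB opprK [in RHS]addnC addnA [in RHS]addnAC.
by case: sorted; case: sorted; case: (0%N \notin _); case: (0%N \notin _).
Qed.

Variable R : realType.
Local Notation C := (Cplx R).

(** The substitution m |-> -m acts inside each coefficient of q^n, so the partial sums agree and
    convergence is not involved. *)
Lemma unimodal_gfV (z q : C) : unimodal_gf z^-1 q = unimodal_gf z q.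
Proof.
have E n : \sum_(m \in [set: int]) (unimodal_count m n)%:R * z^-1 ^ m * q ^+ n =
           \sum_(m \in [set: int]) (unimodal_count m n)%:R * z ^ m * q ^+ n.
  have oppB : bijective (fun m : int => - m) by exists (fun m : int => - m) => m; rewrite opprK.
  transitivity (\sum_(m \in [set: int]) (unimodal_count (- m) n)%:R * z^-1 ^ (- m) * q ^+ n).
    exact: (reindex_fsbigT _ (fun m : int => (unimodal_count m n)%:R * z^-1 ^ m * q ^+ n) oppB).
  by apply: eq_fsbigr => m _; rewrite unimodal_countN exprz_inv opprK.
by rewrite /unimodal_gf; under eq_fun do under eq_bigr do rewrite E.
Qed.

End Symmetry.

(** * The expansion as an identity of analytic functions of w *)

Section Expansion.
Variable R : realType.
Local Notation C := (Cplx R).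
Implicit Types (z w h : C) (a : nat -> C) (r rho : R) (F G : nat -> C -> C).

(** Convergence at a point bounds the terms there, as differences of consecutive partial sums. This
    makes the series S of the expansion analytic. *)
Lemma radius_of_cvg a r :
  (forall w, 0 < cabs w < r -> exists S : C,
     (fun N => \sum_(0 <= n < N) a n * w ^+ n) @ \oo --> S) ->
  has_radius a r.
Proof.
move=> H rho /andP[]; rewrite le_eqVlt => /orP[/eqP <- _|rho0 rhor].
  exists (cabs (a 0%N)) => -[|n]; first by rewrite expr0 mulr1.
  by rewrite expr0n mulr0 cabs_ge0.
have rE : cabs (real_complex R rho) = rho by rewrite cabs_real gtr0_norm.
have [|S cS] := H (real_complex R rho); first by rewrite rE rho0.
have /cabs_cvgP/(_ _ ltr01)[N0 _ HN] := cS.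
pose b n := cabs (a n) * rho ^+ n.
have b0 n : 0 <= b n by rewrite mulr_ge0 ?cabs_ge0// exprn_ge0// ltW.
have s0 N : 0 <= \sum_(0 <= n < N) b n by exact: sumr_ge0.
(* From N0 on, partial sums lie within 1 of the limit, so a term is below 2; earlier terms are
   bounded by their own finite sum. *)
exists (2 + \sum_(0 <= n < N0) b n) => n; rewrite -/(b n).
have [nN|Nn] := ltnP n N0.
  have E : \sum_(0 <= i < N0) b i = \sum_(0 <= i < n) b i + (b n + \sum_(n.+1 <= i < N0) b i).
    by rewrite (@big_cat_nat _ _ _ n)//= 1?ltnW// (big_ltn nN).
  have p1 := s0 n; have p2 : 0 <= \sum_(n.+1 <= i < N0) b i by exact: sumr_ge0.
  by rewrite E; lra.
have h1 := HN _ Nn; have h2 := HN _ (leqW Nn).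
have : b n = cabs (\sum_(0 <= n < n.+1) a n * real_complex R rho ^+ n
    - \sum_(0 <= n < n) a n * real_complex R rho ^+ n).
  by rewrite big_nat_recr//= addrAC subrr add0r cabsM cabsX rE.
move: h1 h2 => /=; set X := \sum_(_ <= _ < n) _; set Y := \sum_(_ <= _ < _) _ => h1 h2 ->.
have -> : Y - X = (Y - S) + (S - X) by ring.
apply: (le_trans (cabsD _ _)); rewrite (cabsB S).
by have := s0 N0; lra.
Qed.

Lemma psum_shift a r z : has_radius a r -> cabs z < r ->
  psum a z = a 0%N + z * psum (fun n => a n.+1) z.
Proof.
move=> ga zr; have c1 := cvg_succ (psum_cvg ga zr).
have c2 : (fun N => \sum_(0 <= n < N.+1) a n * z ^+ n) @ \oo -->
  a 0%N + z * psum (fun n => a n.+1) z; last first.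
  by have := cvg_unique (@norm_hausdorff _ _) c1 c2; apply.
have E N : \sum_(0 <= n < N.+1) a n * z ^+ n = a 0%N + z * \sum_(0 <= n < N) a n.+1 * z ^+ n.
  rewrite big_nat_recl//= expr0 mulr1; congr (_ + _).
  by rewrite mulr_sumr; apply: eq_bigr => n _; rewrite exprS mulrCA.
under eq_fun do rewrite E.
by apply: (cvgD (cvg_cst (a 0%N))); apply: cvgM; [exact: cvg_cst|exact: psum_cvg (radius_shift ga) zr].
Qed.

(** Taylor coefficients of (e^w - 1)/w. *)
Definition expm1_quot : nat -> C := fun n => efact R n.+1.

Lemma psum_expm1 z : z * psum expm1_quot z = cexp z - 1.
Proof.
rewrite cexpE (psum_shift (@radius_efact R (cabs z + 1)))//; last by rewrite ltrDl.
have -> : efact R 0 = 1 by rewrite /efact fact0 invr1.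
by rewrite [1 + _]addrC addrK.
Qed.

Variables (u : nat -> C -> C) (tau : C).
Hypothesis u_def : unimodal_expansion u tau.
Let q := nome tau.

Definition ucoef n : C := if n is 0 then 0 else u n tau / n`!%:R.

(** With w = 2 pi i z, one has sin(pi z)/(pi z) = e^(-w/2) (e^w - 1)/w. *)
Lemma unimodal_expansion_ball : exists2 r : R, 0 < r & has_radius ucoef r /\
  forall w, cabs w < r ->
    unimodal_gf (cexp w) q =
      unimodal_gf 1 q * (psum expm1_quot w * cexp (2 * psum ucoef w - w / 2)).
Proof.
have c0 : 2 * piC R * 'i != 0.
  rewrite !mulf_neq0 ?neq0Ci ?pnatr_eq0// /piC.
  by rewrite fmorph_eq0 gt_eqF// pi_gt0.
move: u_def; rewrite /unimodal_expansion near_withinE => /cabs_nbhsP[d d0 H].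
set c := 2 * piC R * 'i in c0 H *.
have Hw w : 0 < cabs w < d * cabs c -> exists2 S : C,
    (fun N => \sum_(0 <= n < N) ucoef n * w ^+ n) @ \oo --> S &
    unimodal_gf (cexp w) q =
        csin (piC R * (w / c)) / (piC R * (w / c)) * unimodal_gf 1 q * cexp (2 * S).
  move=> /andP[w0 wd]; have := H (w / c).
  rewrite subr0 cabsM cabsV ltr_pdivrMr ?cabs_gt0// => /(_ wd) [].
    by rewrite mulf_neq0 ?invr_eq0// -cabs_gt0.
  move=> S cS HS; have cw : c * (w / c) = w by rewrite mulrC divfK.
  rewrite cw in HS; exists S => //.
  have E N : \sum_(0 <= n < N) ucoef n * w ^+ n =
      \sum_(1 <= k < N) u k tau * (c * (w / c)) ^+ k / k`!%:R.
    case: N => [|N]; first by rewrite !big_nil.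
    rewrite cw big_nat_recl//= mul0r add0r big_add1/=; apply: eq_bigr => k _.
    by rewrite mulrAC.
  by under eq_fun do rewrite E.
have r0 : 0 < d * cabs c by rewrite mulr_gt0// cabs_gt0.
have ga : has_radius ucoef (d * cabs c) by apply: radius_of_cvg => w /Hw[S]; exists S.
exists (d * cabs c) => //; split=> // w wr.
(* The expansion is assumed only for z <> 0; at w = 0 both sides equal U(1; q). *)
have [->|w0] := eqVneq w 0.
  by rewrite !psum0 cexp0 mulr0 mul0r subr0 cexp0 /expm1_quot /efact invr1 !mulr1.
have [|S cS ->] := Hw w; first by rewrite cabs_gt0 w0.
rewrite (psum_unique cS) [csin _ / _ * _]mulrC -[LHS]mulrA; congr (_ * _).
have -> : psum expm1_quot w = (cexp w - 1) / w by rewrite -psum_expm1 mulrAC divff// mul1r.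
rewrite cexpD [cexp (2 * _) * _]mulrC [RHS]mulrA; congr (_ * _).
have cw : c * (w / c) = w by rewrite mulrC divfK.
have wE : 2 * 'i * (piC R * (w / c)) = w by rewrite -[RHS]cw {2}/c; ring.
rewrite /csin.
have -> : 'i * (piC R * (w / c)) = w / 2.
  have t0 : (2 : C) != 0 by rewrite pnatr_eq0.
  by apply: (mulIf t0); rewrite (divfK t0) -[RHS]wE; ring.
have ww : cexp (w / 2) * cexp (w / 2) = cexp w by rewrite -cexpD -splitr.
have kk : cexp (w / 2) * cexp (- (w / 2)) = 1 by exact: cexpK.
rewrite /csin -mulrA -invfM wE [RHS]mulrAC; congr (_ / _).
by rewrite -ww mulrBl mul1r -mulrA kk mulr1.
Qed.

End Expansion.

Lemma sum_double (A : nmodType) (f : nat -> A) n :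
  \sum_(i < n.*2) f i = \sum_(j < n) (f j.*2 + f j.*2.+1).
Proof.
elim: n => [|n ih]; first by rewrite !big_ord0.
by rewrite doubleS !big_ord_recr/= ih addrA.
Qed.

(** * Recursion for the normalized moments *)

Section Moments.
Variable R : realType.
Local Notation C := (Cplx R).
Variables (u : nat -> C -> C) (tau : C).
Hypothesis u_def : unimodal_expansion u tau.
Hypothesis U1_neq0 : unimodal_gf 1 (nome tau) != 0.
Let q := nome tau.
Let m k := normalized_moment k q.
Let Qs i : C := (i.+1%:R)^-1.
Let gs i : C := 2 * u i.+1 tau - (i == 0)%:R / 2.

(** Both facts come from one tower [T] for w |-> U(e^w; q): its values at 0 are the moments, and its
    function of order 0 is even. *)
Let moments_bexp_odd : (forall n, m n = bconv Qs (bexp gs 1) n) /\ (forall n, odd n -> m n = 0).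
Proof.
have [r r0 [ga H]] := unimodal_expansion_ball u_def.
(* Derivatives of 2 S(w) - w/2, beginning with the first; the linear term contributes -1/2 at order
   0 only. *)
pose G n z := 2 * psum (iter n (@diffs R) (diffs (ucoef u tau))) z - (n == 0)%:R / 2 : C.
have tG : tower r G.
  move=> n z zr.
  have := derD (derM (der_cst 2 z) (tower_psum (radius_diffs ga) n zr))
    (der_cst (- ((n == 0)%:R / 2)) z).
  by move=> /is_derive_eq; apply; rewrite /G /= mul0r add0r addr0 mul0r subr0.
pose e z : C := cexp (2 * psum (ucoef u tau) z - z / 2).
have de z : cabs z < r -> is_derive z 1 e (G 0%N z * e z).
  move=> zr; have d1 : is_derive z 1 (fun z => 2 * psum (ucoef u tau) z - z / 2 : C) (G 0%N z).
    have := derD (derM (der_cst 2 z) (is_derive_psum ga zr))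
      (is_deriveN (derM (der_id z) (der_cst 2^-1 z))).
    by move=> /is_derive_eq; apply; rewrite /G /= mul0r add0r mulr0 addr0.
  by have := is_derive_chain d1 (is_derive_cexp _); rewrite mulrC.
pose Q n := psum (iter n (@diffs R) (expm1_quot R)).
have tQ : tower r Q by apply: tower_psum; exact: radius_shift (@radius_efact R r).
pose E n z := bexp (G ^~ z) (e z) n.
have tE : tower r E by exact: tower_bexp.
pose T n z := unimodal_gf 1 q * bconv (Q ^~ z) (E ^~ z) n.
have tT : tower r T.
  move=> n z zr; have := derM (der_cst (unimodal_gf 1 q) z) (tower_bconv tQ tE n zr).
  by move=> /is_derive_eq; apply; rewrite mul0r add0r.
have T0 w : cabs w < r -> unimodal_gf (cexp w) q = T 0%N w.
  by move=> wr; rewrite (H _ wr) /T /bconv big_ord1 bin0 mul1r.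
have [d d0 th] := theta_tower (U := fun x => unimodal_gf x q) r0 tT T0.
have mT k : unimodal_moment k q = T k 0.
  by rewrite /unimodal_moment th ?clog1// subrr cabs0.
have f0 n : (n`!%:R : C) != 0 by rewrite pnatr_eq0 -lt0n fact_gt0.
have mE k : m k = bconv Qs (bexp gs 1) k.
  rewrite /m /normalized_moment mT /T mulrAC mulfV// mul1r.
  apply: eq_bconv => i.
    by rewrite /Q psum_iter_diffs0 /expm1_quot /efact factS natrM invfM mulrCA divff ?f0// mulr1.
  have Gg : G ^~ 0 = gs.
    apply/funext => j; rewrite /G psum_iter_diffs0 /diffs /=.
    rewrite [_`!%:R * (_ * _)]mulrA -natrM mulnC -factS.
    by rewrite /gs [_`!%:R * _]mulrC divfK ?f0.
  have e0 : e 0 = 1 by rewrite /e psum0 mulr0 mul0r subr0 cexp0.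
  by rewrite -[LHS]/(bexp (G ^~ 0) (e 0) i) Gg e0.
split=> // n on; have evT : forall z, cabs z < r -> T 0%N (- z) = T 0%N z.
  move=> z zr; have zr' : cabs (- z) < r by rewrite cabsN.
  by rewrite -(T0 z zr) -(T0 (- z) zr') cexpN unimodal_gfV.
have := tower_even tT evT n (z := 0); rewrite oppr0 cabs0 => /(_ r0).
rewrite -signr_odd on expr1 mulN1r => /eqP; rewrite -subr_eq0 opprK -mulr2n mulrn_eq0/= => /eqP.
by rewrite -mT /m /normalized_moment => ->; rewrite mul0r.
Qed.

(** The i-th derivative at 0 of F'/F. At i = 0 the contribution 1 + B_1 = 1/2 of Q'/Q cancels the
    -1/2 from e^(-w/2), hence the factor [(0 < i)]. *)
Definition log_moment i : C :=
  2 * u i.+1 tau + (0 < i)%:R * (ratr (bernoulli_number i.+1) / i.+1%:R).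

Lemma moment0 : m 0 = 1.
Proof.
by rewrite (moments_bexp_odd.1 0) /bconv big_ord1 bin0 mul1r bexp0 mulr1 /Qs invr1.
Qed.

(** This is F' = (F'/F) F at 0. For F = Q E up to a constant, Q' comes from [inv_succ_bconv] and E'
    from [bexpS]; associativity of the convolution collects the two logarithmic derivatives. *)
Lemma moment_rec n : m n.+1 = bconv log_moment m n.
Proof.
have mE := moments_bexp_odd.1.
rewrite mE bconv_shift.
rewrite (@eq_bconv _ _ (bconv (cothK C) Qs) _ (bexp gs 1)) //; last exact: inv_succ_bconv.
rewrite (@eq_bconv _ Qs Qs (fun i => bexp gs 1 i.+1) (bconv gs (bexp gs 1))
  (fun _ => erefl) (fun i => bexpS gs 1 i)).
have mE' : m =1 bconv Qs (bexp gs 1) by [].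
rewrite (eq_bconv (fun _ => erefl) mE').
rewrite [X in _ + X]bconvA (@eq_bconv _ (bconv Qs gs) (bconv gs Qs) _ (bexp gs 1) (bconvC _ _))//.
rewrite -!bconvA -bconvDl; apply: eq_bconv => // i.
rewrite /cothK /gs /log_moment; case: i => [|i].
  rewrite /= mul0r addr0 divr1 mul1r.
  have -> : bernoulli_number 1 = - 2^-1.
    by rewrite /bernoulli_number/= big_ord1/= bin0 mulr1 mulNr mul1r.
  by rewrite rmorphN fmorphV rmorph_nat; field.
by rewrite /= add0r mul1r mul0r subr0 addrC.
Qed.

Lemma moment_odd n : odd n -> m n = 0.
Proof. exact: moments_bexp_odd.2. Qed.

(** In the recursion for the vanishing odd moment n + 1, terms with i odd contain an odd moment and
    those with i < n even vanish by induction; only the term i = n, times m_0 = 1, is left. *)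
Lemma log_moment_even n : ~~ odd n -> log_moment n = 0.
Proof.
elim/ltn_ind: n => n ih on; have := moment_odd (n := n.+1) on.
rewrite moment_rec /bconv big_ord_recr/= binn mul1r subnn moment0 mulr1.
rewrite big1 ?add0r// => i _; have [oi|oi] := boolP (odd i).
  by rewrite moment_odd ?mulr0// oddB ?(ltnW (ltn_ord i))// (negbTE on) oi.
by rewrite ih// mulr0 mul0r.
Qed.

Lemma log_moment_odd j : log_moment j.*2.+1 = 2 * unimodal_W u (2 * j.+1) tau.
Proof.
rewrite /log_moment /unimodal_W mul1r mulrDr mul2n doubleS; congr (_ + _).
have -> : (2 * j.*2.+2)%:R = 2 * j.*2.+2%:R :> C by rewrite natrM.
by rewrite invfM mulrCA mulVKf// pnatr_eq0.
Qed.

(** In [moment_rec] at 2k + 1 only the indices i = 2j + 1 survive; dividing by factorials absorbs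
    the binomials. This is k y_k = sum_j j x_j y_(k-j), shifted by one. *)
Lemma moment_even_rec k :
  k.+1%:R * (m k.+1.*2 / k.+1.*2`!%:R) =
  \sum_(j < k.+1) j.+1%:R * (2 * unimodal_W u (2 * j.+1) tau / j.+1.*2`!%:R) *
    (m (k - j).*2 / (k - j).*2`!%:R).
Proof.
have f0 n : (n`!%:R : C) != 0 by rewrite pnatr_eq0 -lt0n fact_gt0.
have -> : m k.+1.*2 = \sum_(j < k.+1) 'C(k.*2.+1, j.*2.+1)%:R * log_moment j.*2.+1 * m (k - j).*2.
  rewrite doubleS moment_rec /bconv.
  pose f i : C := 'C(k.*2.+1, i)%:R * log_moment i * m (k.*2.+1 - i)%N.
  rewrite -doubleS (sum_double f); apply: eq_bigr => j _.
  have jk : (j <= k)%N by rewrite -ltnS.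
  by rewrite /f log_moment_even ?odd_double// mulr0 mul0r add0r subSS -doubleB.
rewrite mulr_suml mulr_sumr; apply: eq_bigr => j _; rewrite log_moment_odd.
have jk : (j <= k)%N by rewrite -ltnS.
have E : 'C(k.*2.+1, j.*2.+1)%:R * j.*2.+1`!%:R * (k - j).*2`!%:R = k.*2.+1`!%:R :> C.
  rewrite -!natrM; congr (_%:R); rewrite -(@bin_fact k.*2.+1 j.*2.+1) ?ltnS ?leq_double//.
  by rewrite subSS -doubleB mulnA.
have Ek : k.+1.*2`!%:R = 2 * k.+1%:R * k.*2.+1`!%:R :> C.
  by rewrite doubleS factS natrM -doubleS -mul2n natrM.
have Ej : j.+1.*2`!%:R = 2 * j.+1%:R * j.*2.+1`!%:R :> C.
  by rewrite doubleS factS natrM -doubleS -mul2n natrM.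
rewrite Ek Ej -E.
have k0 : k.+1%:R != 0 :> C by rewrite pnatr_eq0.
have j0 : j.+1%:R != 0 :> C by rewrite pnatr_eq0.
have c0 : 'C(k.*2.+1, j.*2.+1)%:R != 0 :> C.
  by rewrite pnatr_eq0 -lt0n bin_gt0 ltnS leq_double.
move: (f0 j.*2.+1) (f0 (k - j).*2); move: (unimodal_W _ _ _) (m _) k0 j0 c0.
move: (k.+1%:R) (j.+1%:R) ('C(_, _)%:R) (_`!%:R) (_`!%:R) => K J c x y w v K0 J0 c0 x0 y0.
by field; rewrite K0 J0 c0 x0 y0.
Qed.

End Moments.

Local Close Scope classical_set_scope.

(** * Traces as coefficients of exponentials and logarithms *)

Section Multinomial.
Variables (A : comNzRingType) (inv_fact : nat -> A).
Hypothesis inv_factE : forall n, n`!%:R * inv_fact n = 1.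

Lemma inv_fact_prod n i : (i <= n)%N ->
  inv_fact i * inv_fact (n - i) = inv_fact n * 'C(n, i)%:R.
Proof.
move=> ni; rewrite -[LHS]mul1r -[X in X * _ = _](inv_factE n) -(bin_fact ni) !natrM.
have e1 := inv_factE i; have e2 := inv_factE (n - i).
rewrite (_ : _ * (_ * _) =
  inv_fact n * 'C(n, i)%:R * (i`!%:R * inv_fact i) * ((n - i)`!%:R * inv_fact (n - i))); last by ring.
by rewrite e1 e2 !mulr1.
Qed.

(** A product of exponentials is the exponential of the sum; truncation at N does not reach the
    coefficient n < N. *)
Lemma coef_prod_exp (k N n : nat) (x : 'I_k -> A) : (n < N)%N ->
  (\prod_(i < k) \poly_(j < N) (inv_fact j * x i ^+ j))`_n = inv_fact n * (\sum_(i < k) x i) ^+ n.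
Proof.
elim: k n x => [|k ih] n x nN.
  rewrite !big_ord0 coef1 expr0n; case: n nN => [|n] _ /=; last by rewrite mulr0.
  by rewrite mulr1 -[LHS](inv_factE 0) fact0 mul1r.
rewrite !big_ord_recr/= coefM [X in X ^+ n]addrC exprDn mulr_sumr; apply: eq_bigr => i _.
have ni : (i <= n)%N by rewrite -ltnS.
rewrite ih ?(leq_ltn_trans ni)// coef_poly (leq_ltn_trans (leq_subr _ _) nN).
have e := inv_fact_prod ni; rewrite -mulr_natr.
move: (\sum_(i0 < k) _) (x ord_max) => s t.
rewrite mulrACA e; ring.
Qed.

(** Distributing the product of truncated exponentials gives one monomial per m. Inverse factorials
    are a parameter because the lemma is used over [{poly F}], which is not a field. *)
Lemma multinomial (k N n : nat) (x : 'I_k -> A) : (n < N)%N ->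
  inv_fact n * (\sum_(i < k) x i) ^+ n =
  \sum_(m : {ffun 'I_k -> 'I_N} | (\sum_(i < k) m i == n)%N)
    \prod_(i < k) (inv_fact (m i) * x i ^+ m i).
Proof.
move=> nN; rewrite -(coef_prod_exp x nN).
under eq_bigr do rewrite poly_def.
rewrite bigA_distr_bigA coef_sum/= [RHS]big_mkcond/=; apply: eq_bigr => m _.
have -> : \prod_i ((inv_fact (m i) * x i ^+ m i) *: 'X^(m i)) =
    (\prod_i (inv_fact (m i) * x i ^+ m i)) *: 'X^(\sum_i m i) :> {poly A}.
  by rewrite scaler_prod -expr_sum.
by rewrite coefZ coefXn eq_sym; case: eqP => _; rewrite ?mulr1 ?mulr0.
Qed.

End Multinomial.

(** * Partition sums and the coefficients of exp and log *)

Section Trace.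
Variable F : numFieldType.
Implicit Types x y : nat -> F.

Definition gpoly x k : {poly F} := \sum_(i < k) x i.+1 *: 'X^(i.+1).

Lemma fact_neq0 n : (n`!%:R : F) != 0.
Proof. by rewrite pnatr_eq0 -lt0n fact_gt0. Qed.

(** Partitions are grouped by length n. The multinomial theorem expands g^n / n!, and the
    coefficient of X^k selects the multiplicities with sum of i m_i equal to k. *)
Lemma partition_sum_coef k (c : nat -> F) x :
  \sum_(m : multiplicities k | is_partition m)
     c (partition_length m) * \prod_(i < k) (x i.+1 ^+ m i / (m i)`!%:R) =
  \sum_(n < k.+1) c n / n`!%:R * (gpoly x k ^+ n)`_k.
Proof.
pose ifact n : {poly F} := (n`!%:R^-1)%:P.
have ifactE n : n`!%:R * ifact n = 1.
  by rewrite -polyC_natr -polyCM mulfV ?fact_neq0.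
have E n : (n < k.+1)%N -> n`!%:R^-1 * (gpoly x k ^+ n)`_k =
   \sum_(m : multiplicities k | (partition_length m == n) && is_partition m)
      \prod_(i < k) (x i.+1 ^+ m i / (m i)`!%:R).
  move=> nk; rewrite -coefCM (multinomial ifactE (fun i : 'I_k => x i.+1 *: 'X^(i.+1)) nk).
  rewrite coef_sum big_mkcondr/=; apply: eq_bigr => m _.
  have -> : \prod_(i < k) (ifact (m i) * (x i.+1 *: 'X^(i.+1)) ^+ m i) =
     (\prod_(i < k) (x i.+1 ^+ m i / (m i)`!%:R)) *: 'X^(\sum_(i < k) i.+1 * m i).
    rewrite expr_sum -scaler_prod; apply: eq_bigr => i _.
    by rewrite exprZn -exprM mul_polyC scalerA mulrC.
  by rewrite coefZ coefXn /is_partition eq_sym; case: eqP => _; rewrite ?mulr1 ?mulr0.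
under [RHS]eq_bigr => n _ do rewrite -mulrA E// mulr_sumr.
rewrite (exchange_big_dep (@is_partition k))/=; last by move=> n m _ /andP[].
apply: eq_bigr => m pm.
(* Parts are at least 1, so the length is at most k and each partition is met for exactly one n. *)
have lm : (partition_length m < k.+1)%N.
  rewrite ltnS -[leqRHS](eqP pm); apply: leq_sum => i _.
  by rewrite leq_pmull.
rewrite (bigD1 (Ordinal lm))/= ?eqxx ?pm// [X in _ + X]big1 ?addr0// => i.
by rewrite andbT => /andP[/eqP e]; rewrite -val_eqE/= -e eqxx.
Qed.

Lemma gpoly_coef x k i : (gpoly x k)`_i = if (0 < i <= k)%N then x i else 0.
Proof.
rewrite /gpoly coef_sum; case: i => [|i].
  by rewrite big1// => j _; rewrite coefZ coefXn mulr0.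
rewrite /=; have [ik|ki] := ltnP i k.
  rewrite (bigD1 (Ordinal ik))//= coefZ coefXn eqxx mulr1 big1 ?addr0// => j.
  by rewrite -val_eqE/= => ij; rewrite coefZ coefXn eqSS eq_sym (negbTE ij) mulr0.
rewrite big1// => j _; rewrite coefZ coefXn eqSS gtn_eqF ?mulr0//.
exact: leq_trans ki.
Qed.

Lemma gpoly_mulX x k : exists Q, gpoly x k = Q * 'X.
Proof.
exists (\sum_(i < k) x i.+1 *: 'X^i); rewrite mulr_suml; apply: eq_bigr => i _.
by rewrite -scalerAl -exprSr.
Qed.

Lemma coef_gpoly_exp x k n i (p : {poly F}) : (i < n)%N -> (p * gpoly x k ^+ n)`_i = 0.
Proof.
move=> ni; have [Q ->] := gpoly_mulX x k.
by rewrite exprMn mulrA coefMXn ni.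
Qed.

Lemma coef0_gpoly_exp x k n : (gpoly x k ^+ n)`_0 = (n == 0)%:R.
Proof.
case: n => [|n]; first by rewrite expr0 coef1.
by rewrite -[_ ^+ _]mul1r coef_gpoly_exp.
Qed.

Lemma coef_deriv_gpoly x k i : (i < k)%N -> (gpoly x k)^`()`_i = i.+1%:R * x i.+1.
Proof. by move=> ik; rewrite coef_deriv gpoly_coef ltn0Sn ik mulr_natl. Qed.

Variables (x y : nat -> F).
Hypothesis y0 : y 0%N = 1.
Hypothesis y_rec : forall k, k.+1%:R * y k.+1 = \sum_(j < k.+1) j.+1%:R * x j.+1 * y (k - j)%N.

(** The truncated exponential E of g satisfies E' = g' E up to a multiple of g^k, which starts in
    degree k. Below that degree this is the recursion of y. *)
Lemma exp_coef k : y k = \sum_(n < k.+1) n`!%:R^-1 * (gpoly x k ^+ n)`_k.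
Proof.
pose E := \sum_(n < k.+1) n`!%:R^-1 *: gpoly x k ^+ n.
have -> : \sum_(n < k.+1) n`!%:R^-1 * (gpoly x k ^+ n)`_k = E`_k.
  by rewrite coef_sum; apply: eq_bigr => n _; rewrite coefZ.
have dE : E^`() = (gpoly x k)^`() * E - k`!%:R^-1 *: ((gpoly x k)^`() * gpoly x k ^+ k).
  rewrite /E raddf_sum big_ord_recl/= expr0 derivZ -polyC1 derivC scaler0 add0r.
  rewrite [X in _ * X - _]big_ord_recr/= mulrDr scalerAr addrK mulr_sumr.
  apply: eq_bigr => n _; rewrite derivZ deriv_exp -[bump 0 n]/n.+1.
  rewrite -[_ * _ *+ _]scaler_nat scalerA -scalerAr.
  by rewrite factS natrM invfM mulrAC mulVf ?mul1r// pnatr_eq0.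
suff H i : (i <= k)%N -> E`_i = y i by rewrite H.
elim/ltn_ind: i => -[_ _|i ih ik].
  rewrite /E coef_sum big_ord_recl/= coefZ coef0_gpoly_exp mulr1.
  rewrite big1 ?addr0 ?y0 ?fact0 ?invr1// => n _.
  by rewrite coefZ coef0_gpoly_exp mulr0.
have i1 : i.+1%:R != 0 :> F by rewrite pnatr_eq0.
apply: (mulfI i1); rewrite y_rec mulr_natl -coef_deriv dE coefB coefZ coef_gpoly_exp// mulr0 subr0.
rewrite coefM; apply: eq_bigr => j _.
have ji : (j <= i)%N by rewrite -ltnS.
rewrite coef_deriv_gpoly ?(leq_ltn_trans ji)// ih//.
  by rewrite ltnS leq_subr.
by rewrite (leq_trans (leq_subr _ _))// ltnW.
Qed.

(** The truncated logarithm L of 1 + Y satisfies (1 + Y) L' = Y' up to a high power of Y. Its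
    coefficients obey the recursion solved for x, whose last term has the factor y_0 = 1. *)
Lemma log_coef k : (0 < k)%N ->
  x k = \sum_(n < k.+1) (-1) ^+ n.-1 * (n.-1)`!%:R / n`!%:R * (gpoly y k ^+ n)`_k.
Proof.
case: k => // k _.
pose Y := gpoly y k.+1.
pose L := \sum_(n < k.+1) ((-1) ^+ n / n.+1%:R) *: Y ^+ n.+1.
have -> : \sum_(n < k.+2) (-1) ^+ n.-1 * (n.-1)`!%:R / n`!%:R * (gpoly y k.+1 ^+ n)`_k.+1 = L`_k.+1.
  (* The term n = 0, where [n.-1] takes its default value 0, vanishes: 1 has no coefficient in
     degree k + 1. *)
  rewrite big_ord_recl expr0 coef1 mulr0 add0r coef_sum; apply: eq_bigr => n _.
  rewrite coefZ lift0 factS natrM invfM mulrA; congr (_ * _).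
  by rewrite mulrAC mulfK ?fact_neq0.
have dL : (1 + Y) * L^`() = Y^`() - (Y^`() * (-1) ^+ k.+1) * Y ^+ k.+1.
  have -> : L^`() = Y^`() * \sum_(n < k.+1) (- Y) ^+ n.
    rewrite /L raddf_sum mulr_sumr; apply: eq_bigr => n _ /=.
    rewrite derivZ deriv_exp -[_ * _ *+ _]scaler_nat scalerA divfK ?pnatr_eq0//.
    by rewrite -[- Y]scaleN1r exprZn scalerAr.
  have geom : (1 + Y) * \sum_(n < k.+1) (- Y) ^+ n = 1 - (- Y) ^+ k.+1.
    by rewrite -[RHS]opprB subrX1; ring.
  by rewrite mulrCA geom -mulrA -exprNn mulrBr mulr1.
suff H i : (i <= k)%N -> L`_i.+1 = x i.+1 by rewrite H.
elim/ltn_ind: i => i ih ik.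
have yE a : (a <= k)%N -> (1 + Y)`_a = y a.
  move=> ak; rewrite coefD coef1 gpoly_coef; case: a ak => [|a] ak /=; first by rewrite addr0 y0.
  by rewrite add0r ltnW.
have := congr1 (fun p : {poly F} => p`_i) dL.
rewrite coefB coef_gpoly_exp ?ltnS// subr0 coef_deriv_gpoly ?ltnS// y_rec mulrC coefM.
rewrite !big_ord_recr/= subnn y0 coef_deriv yE// y0 !mulr1.
rewrite (eq_bigr (fun j : 'I_i => j.+1%:R * x j.+1 * y (i - j)%N)).
  move=> /addrI e; have i1 : i.+1%:R != 0 :> F by rewrite pnatr_eq0.
  by apply: (mulfI i1); rewrite -[RHS]e mulr_natl.
move=> j _; have ji := ltn_ord j.
rewrite coef_deriv ih ?(leq_trans (ltnW ji))// yE ?mulr_natl//.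
by rewrite (leq_trans (leq_subr _ _)).
Qed.

End Trace.

(* The two trace formulas *)
Local Close Scope classical_set_scope.
Theorem corollary4p4 (R : realType) (u : nat -> Cplx R -> Cplx R) (tau : Cplx R)
    (tau_gt0 : 0 < 'Im tau)
    (U1_neq0 : unimodal_gf 1 (nome tau) != 0)
    (u_def : unimodal_expansion u tau)
    (k : nat) (k_ge1 : (1 <= k)%N) :
  normalized_moment (2 * k) (nome tau) =
    partition_trace (@phiM (Cplx R) k) (fun j => unimodal_W u (2 * j) tau)
  /\
  unimodal_W u (2 * k) tau =
    partition_trace (@phiS (Cplx R) k)
      (fun j => normalized_moment (2 * j) (nome tau)).
Proof.
pose F := Cplx R; have f0 n : (n`!%:R : F) != 0 := fact_neq0 F n.
(* The 2 in [x] produces the powers 2^(m_j) of [phiM] and, when solving for W, the factor 1/2 of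
   [phiS]. *)
pose x j : F := 2 * unimodal_W u (2 * j) tau / (2 * j)`!%:R.
pose y j : F := normalized_moment (2 * j) (nome tau) / (2 * j)`!%:R.
have y0 : y 0%N = 1 by rewrite /y muln0 (moment0 u_def U1_neq0) fact0 divr1.
have y_rec n : n.+1%:R * y n.+1 = \sum_(j < n.+1) j.+1%:R * x j.+1 * y (n - j)%N.
  rewrite /y !mul2n (moment_even_rec u_def U1_neq0); apply: eq_bigr => j _.
  by rewrite /x -!mul2n.
split.
  have -> : normalized_moment (2 * k) (nome tau) = (2 * k)`!%:R * y k.
    by rewrite /y [RHS]mulrC divfK.
  rewrite (exp_coef y0 y_rec).
  (* The exponential corresponds to the constant weight 1 on lengths; the logarithm below has weight
     (-1)^(n-1) (n-1)!. *)
  under eq_bigr do rewrite -[n in n * _]mul1r.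
  rewrite -(partition_sum_coef k (fun=> 1)) mulr_sumr; apply: eq_bigr => m _.
  rewrite /phiM mul1r -mulrA -big_split; congr (_ * _); apply: eq_bigr => i _ /=.
  by rewrite /x !exprMn exprVn invfM; ring.
have two0 : (2 : F) != 0 by rewrite pnatr_eq0.
have -> : unimodal_W u (2 * k) tau = (2 * k)`!%:R / 2 * x k.
  by rewrite /x [RHS]mulrC mulrA divfK// mulrC mulKf.
rewrite (log_coef y0 y_rec)//.
rewrite -(partition_sum_coef k (fun n => (-1) ^+ n.-1 * (n.-1)`!%:R)) mulr_sumr.
apply: eq_bigr => m _; rewrite /phiS -!mulrA; do 4 congr (_ * _).
rewrite -big_split; apply: eq_bigr => i _ /=.
by rewrite /y exprMn exprVn invfM; ring.
Qed.
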